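(* Let $G$ be a group acting (without inversions) on a tree $T$. Suppose that there is $M\in\mathbb{N}$ such that every vertex stabilizer is a free abelian group of rank at most $M$, that for every edge $e$ the stabilizer of $e$ is a direct factor of the stabilizers of both endpoints of $e$, and that for all $x,y,z\in G$, if $xy=yx$ and $zxz^{-1}=y$ then $x=y$. If $G$ is not solvable, then $G$ maps onto the non-abelian free group $\mathbb{F}_2$.
   Context: A tree is a connected oriented graph whose topological realization is contractible; a group action on an oriented graph acts on vertices and edges compatibly with the initial and terminal vertex maps (so no edge is inverted). *)

(* Defs.v *)
From Stdlib Require Import List ZArith Bool.
Import ListNotations.

Record group := Group {
  gcar :> Type;
  gmul : gcar -> gcar -> gcar;
  ginv : gcar -> gcar;
  gone : gcar;
  gmulA : forall x y z, gmul x (gmul y z) = gmul (gmul x y) z;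
  gmul1 : forall x, gmul gone x = x;
  gmulV : forall x, gmul (ginv x) x = gone
}.

Arguments gmul {g}.
Arguments ginv {g}.
Arguments gone {g}.

Section GroupDefs.
Variable G : group.

Definition is_subgroup (H : G -> Prop) : Prop :=
  H gone /\ (forall x y, H x -> H y -> H (gmul x y)) /\ (forall x, H x -> H (ginv x)).

Definition gpow_nat (g : G) (n : nat) : G := Nat.iter n (fun h => gmul g h) gone.
Definition gzpow (g : G) (n : Z) : G :=
  match n with
  | Z0 => gone
  | Zpos p => gpow_nat g (Pos.to_nat p)
  | Zneg p => gpow_nat (ginv g) (Pos.to_nat p)
  end.

Fixpoint zcomb (bs : list G) (ns : list Z) : G :=
  match bs, ns with
  | b :: bs', n :: ns' => gmul (gzpow b n) (zcomb bs' ns')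
  | _, _ => gone
  end.

Definition free_abelian_basis (H : G -> Prop) (bs : list G) : Prop :=
  Forall H bs /\
  (forall x y, In x bs -> In y bs -> gmul x y = gmul y x) /\
  (forall h, H h <-> exists ns, length ns = length bs /\ zcomb bs ns = h) /\
  (forall ns ns', length ns = length bs -> length ns' = length bs ->
     zcomb bs ns = zcomb bs ns' -> ns = ns').

Definition free_abelian_rank_le (M : nat) (H : G -> Prop) : Prop :=
  exists bs, length bs <= M /\ free_abelian_basis H bs.

Definition normal_in (A B : G -> Prop) : Prop :=
  forall a b, A a -> B b -> A (gmul (gmul b a) (ginv b)).

Definition direct_factor (A B : G -> Prop) : Prop :=
  is_subgroup A /\ is_subgroup B /\ (forall a, A a -> B a) /\
  exists C : G -> Prop,
    is_subgroup C /\ (forall c, C c -> B c) /\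
    normal_in A B /\ normal_in C B /\
    (forall g, A g -> C g -> g = gone) /\
    (forall b, B b -> exists a c, A a /\ C c /\ b = gmul a c).

Definition commutator (x y : G) : G := gmul (gmul (ginv x) (ginv y)) (gmul x y).

Definition comm_closure (D : G -> Prop) : G -> Prop :=
  fun g => exists l : list (G * G),
    Forall (fun p => D (fst p) /\ D (snd p)) l /\
    g = fold_right (fun p acc => gmul (commutator (fst p) (snd p)) acc) gone l.

Fixpoint derived (n : nat) : G -> Prop :=
  match n with
  | O => fun _ => True
  | S m => comm_closure (derived m)
  end.

Definition solvable : Prop := exists n, forall g, derived n g -> g = gone.

(* a letter (a, s): generator a, exponent +1 if s = true, -1 otherwise *)
Definition letter := (bool * bool)%type.

Fixpoint reduced_word (w : list letter) : Prop :=
  match w with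
  | l1 :: ((l2 :: _) as w') => ~ (fst l1 = fst l2 /\ snd l2 = negb (snd l1)) /\ reduced_word w'
  | _ => True
  end.

Definition cons_red (l : letter) (w : list letter) : list letter :=
  match w with
  | m :: w' => if Bool.eqb (fst m) (fst l) && Bool.eqb (snd m) (negb (snd l))
               then w' else l :: w
  | [] => [l]
  end.

Definition f2mul (u v : list letter) : list letter := fold_right cons_red v u.

Definition maps_onto_F2 : Prop :=
  exists phi : G -> list letter,
    (forall g, reduced_word (phi g)) /\
    (forall g h, phi (gmul g h) = f2mul (phi g) (phi h)) /\
    (forall w, reduced_word w -> exists g, phi g = w).

End GroupDefs.

Section Graphs.
Variables (V E : Type) (src tgt : E -> V).

Definition ostart (e : E) (b : bool) : V := if b then src e else tgt e.
Definition oend (e : E) (b : bool) : V := if b then tgt e else src e.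

Fixpoint walk (x : V) (p : list (E * bool)) (y : V) : Prop :=
  match p with
  | [] => x = y
  | (e, b) :: p' => ostart e b = x /\ walk (oend e b) p' y
  end.

Fixpoint reduced_path (p : list (E * bool)) : Prop :=
  match p with
  | (e1, b1) :: (((e2, b2) :: _) as p') => ~ (e1 = e2 /\ b2 = negb b1) /\ reduced_path p'
  | _ => True
  end.

(* a tree: nonempty, connected, no nontrivial closed reduced path
   (equivalent to contractibility of the topological realization) *)
Definition is_tree : Prop :=
  inhabited V /\
  (forall x y, exists p, walk x p y) /\
  (forall x p, p <> [] -> walk x p x -> reduced_path p -> False).
End Graphs.

(* action of G on the oriented graph (vertices and edges compatibly with
   src/tgt; hence without inversions) *)
Definition graph_action (G : group) (V E : Type) (src tgt : E -> V)
    (av : G -> V -> V) (ae : G -> E -> E) : Prop :=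
  (forall v, av gone v = v) /\
  (forall g h v, av (gmul g h) v = av g (av h v)) /\
  (forall e, ae gone e = e) /\
  (forall g h e, ae (gmul g h) e = ae g (ae h e)) /\
  (forall g e, src (ae g e) = av g (src e)) /\
  (forall g e, tgt (ae g e) = av g (tgt e)).

Definition vstab (G : group) (V : Type) (av : G -> V -> V) (v : V) : G -> Prop :=
  fun g => av g v = v.
Definition estab (G : group) (E : Type) (ae : G -> E -> E) (e : E) : G -> Prop :=
  fun g => ae g e = e.

(* Main.v *)
(** By Bass-Serre theory it suffices to find functionals on the vertex stabilizers.  Fix a subtree
    [S] meeting every vertex orbit once.  Homomorphisms from the stabilizers of the vertices of [S]
    to [F2] that agree on the edges of [S] and kill the stabilizers of the other edges extend to [G],
    and the stable letters may be sent anywhere.  Since edge groups are retracts of vertex groups,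
    it is enough to prescribe the homomorphisms on a subtree of [S].
    - If the quotient graph has two independent cycles, kill all stabilizers.
    - If it is a tree and [G] is not abelian, take a shortest path that embeds in the quotient
      and whose ends [p], [q] have noncommuting stabilizers: neither [G_p] nor [G_q] is contained in
      the group of the next vertex on the path, so both map onto Z killing the edges of the path.
    - If it has one cycle, lift it to a line [y_k] with translation [t].  By the hypothesis on
      conjugates, [t] centralizes the elements fixing a fundamental segment of the line.  If
      some [G_{y_(k+1)}] is not contained in [G_{y_k}], a functional on a segment of the line that
      starts at [y_(k+1)] kills both ends; cut the cycle there and send [t] to the second generator.
      Otherwise all [G_{y_k}] are one group [K] centralized by [t]; unless [G] is abelian, some
      vertex off the line has a stabilizer not contained in [K] and carries a functional. *)

Require Import Defs.
From Stdlib Require Import List ZArith Bool.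
From Stdlib Require Import Lia Wf_nat.
From Stdlib Require Import Classical ClassicalEpsilon FunctionalExtensionality PropExtensionality ProofIrrelevance.
Import ListNotations.

Declare Scope grp_scope.
Delimit Scope grp_scope with grp.
Notation "x ** y" := (gmul x y) (at level 40, left associativity) : grp_scope.
Notation "x ^-1" := (ginv x) (at level 2, left associativity, format "x ^-1") : grp_scope.
Local Open Scope grp_scope.

(** * Groups and homomorphisms defined on subgroups *)

Section GroupTheory.
Context {G : group}.
Implicit Types (x y z g h : G) (A B H P S U : G -> Prop).

Lemma gcancel x y z : x ** y = x ** z -> y = z.
Proof.
  intros E. rewrite <- (gmul1 _ y), <- (gmul1 _ z), <- !(gmulV _ x), <- !gmulA.
  now rewrite E.
Qed.

Lemma gmul1r x : x ** gone = x.
Proof. apply (gcancel (x^-1)). now rewrite gmulA, gmulV, gmul1. Qed.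

Lemma gmulVr x : x ** x^-1 = gone.
Proof. apply (gcancel (x^-1)). now rewrite gmulA, gmulV, gmul1, gmul1r. Qed.

Lemma gmulK x y : x^-1 ** (x ** y) = y.
Proof. now rewrite gmulA, gmulV, gmul1. Qed.

Lemma gmulVK x y : x ** (x^-1 ** y) = y.
Proof. now rewrite gmulA, gmulVr, gmul1. Qed.

Lemma ginv_unique x y : x ** y = gone -> y = x^-1.
Proof. intros E. apply (gcancel x). now rewrite E, gmulVr. Qed.

Lemma ginvK x : (x^-1)^-1 = x.
Proof. symmetry. apply ginv_unique. apply gmulV. Qed.

Lemma ginvM x y : (x ** y)^-1 = y^-1 ** x^-1.
Proof. symmetry. apply ginv_unique. now rewrite <- gmulA, gmulVK, gmulVr. Qed.

Lemma ginv1 : (gone : G)^-1 = gone.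
Proof. symmetry. apply ginv_unique. apply gmul1. Qed.
End GroupTheory.

Ltac gsimp := repeat (rewrite ?ginvM, ?ginvK, ?ginv1, ?gmul1, ?gmul1r,
  ?gmulV, ?gmulVr, ?gmulK, ?gmulVK, <- ?gmulA).
Ltac gsimp_in H := repeat (rewrite ?ginvM, ?ginvK, ?ginv1, ?gmul1, ?gmul1r,
  ?gmulV, ?gmulVr, ?gmulK, ?gmulVK, <- ?gmulA in H).

Section Subgroups.
Context {G : group}.
Implicit Types (x y z g h : G) (A B H P S U : G -> Prop).

Lemma commute_inv x y : x ** y = y ** x -> x^-1 ** y = y ** x^-1.
Proof. intros E. apply (gcancel x). gsimp. rewrite gmulA, E. now gsimp. Qed.

Definition commuting A B := forall x y, A x -> B y -> x ** y = y ** x.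

Lemma centralizer_subgroup A : is_subgroup G (fun x => forall y, A y -> x ** y = y ** x).
Proof.
  repeat split.
  - intros y _. now gsimp.
  - intros x z Hx Hz y Hy. now rewrite <- gmulA, Hz, gmulA, Hx, <- gmulA.
  - intros x Hx y Hy. apply commute_inv. auto.
Qed.

Definition hom_on {L : group} A (f : G -> L) := forall x y, A x -> A y -> f (x ** y) = f x ** f y.
Definition zhom_on A (f : G -> Z) := forall x y, A x -> A y -> f (x ** y) = (f x + f y)%Z.

Lemma hom_on_1 {L : group} A (f : G -> L) : is_subgroup G A -> hom_on A f -> f gone = gone.
Proof.
  intros (H1 & _) Hf. apply (gcancel (f gone)).
  rewrite <- Hf, gmul1, gmul1r; auto.
Qed.

Lemma hom_on_inv {L : group} A (f : G -> L) x :
  is_subgroup G A -> hom_on A f -> A x -> f (x^-1) = (f x)^-1.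
Proof.
  intros HA Hf Hx. apply ginv_unique. rewrite <- Hf; auto; [|now apply HA].
  rewrite gmulVr. eapply hom_on_1; eauto.
Qed.

Lemma zhom_on_1 A (f : G -> Z) : is_subgroup G A -> zhom_on A f -> f gone = 0%Z.
Proof.
  intros (H1 & _) Hf. specialize (Hf gone gone H1 H1). rewrite gmul1 in Hf. lia.
Qed.

Lemma zhom_on_inv A (f : G -> Z) x :
  is_subgroup G A -> zhom_on A f -> A x -> f (x^-1) = (- f x)%Z.
Proof.
  intros HA Hf Hx. assert (E := Hf x (x^-1) Hx (proj2 (proj2 HA) _ Hx)).
  rewrite gmulVr, (zhom_on_1 A) in E; auto. lia.
Qed.

Lemma subgroup_cap A B : is_subgroup G A -> is_subgroup G B -> is_subgroup G (fun x => A x /\ B x).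
Proof.
  intros (?&?&?) (?&?&?). repeat split; try tauto.
  - apply H0; tauto.
  - apply H3; tauto.
  - apply H1; tauto.
  - apply H4; tauto.
Qed.

Lemma gzpow_succ g n : gzpow G g (Z.succ n) = g ** gzpow G g n.
Proof.
  destruct n as [|p|p]; simpl.
  - reflexivity.
  - replace (p + 1)%positive with (Pos.succ p) by lia. now rewrite Pos2Nat.inj_succ.
  - destruct (Pos.eq_dec p 1) as [->|Hp]; [simpl; now gsimp|].
    rewrite <- (Pos.succ_pred p Hp). rewrite Pos2Nat.inj_succ.
    change (Z.pos_sub 1 (Pos.succ (Pos.pred p))) with (1 + Z.neg (Pos.succ (Pos.pred p)))%Z.
    replace (1 + Z.neg (Pos.succ (Pos.pred p)))%Z with (Z.neg (Pos.pred p)) by lia.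
    simpl. now gsimp.
Qed.

(** [Z.bi_induction] asks for an equivalence between the claims at [n] and [n + 1]; cancellation
    supplies the backward half. *)
Lemma gzpow_add g n m : gzpow G g (n + m) = gzpow G g n ** gzpow G g m.
Proof.
  revert n. apply Z.bi_induction.
  - now intros ? ? ->.
  - now rewrite gmul1.
  - intros n. rewrite Z.add_succ_l, !gzpow_succ, <- gmulA.
    split; [now intros ->|apply gcancel].
Qed.

Lemma gzpow_opp g n : gzpow G g (- n) = (gzpow G g n)^-1.
Proof. apply ginv_unique. now rewrite <- gzpow_add, Z.add_opp_diag_r. Qed.

Lemma gzpow_mul g n m : gzpow G g (n * m) = gzpow G (gzpow G g n) m.
Proof.
  revert m. apply Z.bi_induction.
  - now intros ? ? ->.
  - now rewrite Z.mul_0_r.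
  - intros m. rewrite Z.mul_succ_r, Z.add_comm, gzpow_add, gzpow_succ.
    split; [now intros ->|apply gcancel].
Qed.

Lemma gzpow_1 g : gzpow G g 1 = g.
Proof. apply gmul1r. Qed.

Lemma gzpow_in U g n : is_subgroup G U -> U g -> U (gzpow G g n).
Proof.
  intros (H1 & HM & HV) Hg. revert n. apply Z.bi_induction.
  - now intros ? ? ->.
  - exact H1.
  - intros n. rewrite gzpow_succ. split; intros H; [now apply HM|].
    rewrite <- (gmulK g (gzpow G g n)). apply HM; auto.
Qed.

Lemma gzpow_commute g h n : g ** h = h ** g -> gzpow G g n ** h = h ** gzpow G g n.
Proof.
  intros E. apply (gzpow_in (fun x => forall y, h = y -> x ** y = y ** x)); auto.
  - apply centralizer_subgroup.
  - now intros y <-.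
Qed.

Lemma gzpow_mulg g h n : g ** h = h ** g -> gzpow G (g ** h) n = gzpow G g n ** gzpow G h n.
Proof.
  intros E. revert n. apply Z.bi_induction.
  - now intros ? ? ->.
  - now rewrite gmul1.
  - intros n. rewrite !gzpow_succ.
    replace (g ** gzpow G g n ** (h ** gzpow G h n)) with (g ** h ** (gzpow G g n ** gzpow G h n)).
    + split; [now intros ->|apply gcancel].
    + rewrite <- !gmulA. f_equal. rewrite !gmulA. f_equal. symmetry. now apply gzpow_commute.
Qed.

Lemma zcomb_in U bs ns : is_subgroup G U -> Forall U bs -> U (zcomb G bs ns).
Proof.
  intros HU Hbs. revert ns. induction Hbs as [|b bs Hb _ IH]; intros ns; simpl; [apply HU|].
  destruct ns as [|n ns]; [apply HU|]. apply HU; [apply gzpow_in; auto|apply IH].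
Qed.

Lemma zcomb_pow bs ns k :
  (forall x y, In x bs -> In y bs -> x ** y = y ** x) ->
  gzpow G (zcomb G bs ns) k = zcomb G bs (map (fun n => n * k)%Z ns).
Proof.
  assert (E1 : gzpow G gone k = gone).
  { change gone with (gzpow G gone 0) at 1. now rewrite <- gzpow_mul. }
  revert ns. induction bs as [|b bs IH]; intros ns C; simpl; [exact E1|].
  destruct ns as [|n ns]; simpl; [exact E1|].
  rewrite gzpow_mulg, <- gzpow_mul, IH; auto.
  - intros; apply C; simpl; auto.
  - apply gzpow_commute. symmetry.
    apply (zcomb_in (fun x => forall y, b = y -> x ** y = y ** x)).
    + apply centralizer_subgroup.
    + apply Forall_forall. intros x Hx y <-. apply C; simpl; auto.
    + reflexivity.
Qed.

Definition torsion_free B := forall x n, B x -> n <> 0%Z -> gzpow G x n = gone -> x = gone.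

(** Generation is stated through subgroups rather than words, so that it serves directly as an
    induction principle. *)
Definition finitely_generated B :=
  exists bs, Forall B bs /\ forall U, is_subgroup G U -> Forall U bs -> forall x, B x -> U x.

Record fgtf_abelian B : Prop := {
  fgtf_sub : is_subgroup G B;
  fgtf_comm : commuting B B;
  fgtf_fg : finitely_generated B;
  fgtf_tf : torsion_free B }.

Lemma free_abelian_fgtf M B : is_subgroup G B -> free_abelian_rank_le G M B -> fgtf_abelian B.
Proof.
  intros HB (bs & _ & Hbs & C & Hgen & Huniq).
  assert (gen : forall U, is_subgroup G U -> Forall U bs -> forall x, B x -> U x).
  { intros U HU Hb x Hx. apply Hgen in Hx. destruct Hx as (ns & _ & <-). now apply zcomb_in. }
  split; auto.
  - intros x y Hx Hy. revert x Hx y Hy.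
    apply (gen (fun x => forall y, B y -> x ** y = y ** x)); [apply centralizer_subgroup|].
    apply Forall_forall. intros x Hx.
    assert (K : forall y, B y -> forall z, In z bs -> y ** z = z ** y).
    { apply (gen (fun y => forall z, In z bs -> y ** z = z ** y)); [apply (centralizer_subgroup (fun z => In z bs))|].
      apply Forall_forall. intros; apply C; auto. }
    intros y Hy. symmetry. apply K; auto.
  - exists bs; auto.
  - intros x k Hx Hk E. apply Hgen in Hx. destruct Hx as (ns & Hl & <-).
    rewrite zcomb_pow in E by auto.
    assert (Z0 : zcomb G bs (map (fun _ => 0%Z) ns) = gone).
    { clear. revert ns. induction bs as [|b bs IH]; intros [|n ns]; simpl; auto.
      now rewrite IH, gmul1. }
    rewrite <- Z0 in E. apply Huniq in E; [|now rewrite length_map|now rewrite length_map].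
    (* The goal becomes [ns = map (fun n => n * k) ns]. It holds entrywise: [n * k = 0] with
       [k <> 0] forces [n = 0]. *)
    rewrite <- Z0. f_equal. rewrite <- E.
    rewrite <- (map_id ns) at 1. apply map_ext_in. intros n Hn.
    assert (In (n * k)%Z (map (fun n => n * k)%Z ns)) as Hi by (now apply in_map with (f := fun n => (n * k)%Z)).
    rewrite E in Hi. apply in_map_iff in Hi. destruct Hi as (m & Hm & _).
    assert (n = 0%Z) by (destruct (Z.eq_mul_0 n k) as [W _]; destruct W; auto; lia).
    subst; lia.
Qed.

(** * Integer-valued homomorphisms on finitely generated abelian subgroups *)

(** A subgroup of [G * Z] that meets [1 * Z] trivially is the graph of a homomorphism on its
    projection to [G]. *)
Lemma zhom_of_relation (R : G -> Z -> Prop) :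
  R gone 0%Z ->
  (forall x y u v, R x u -> R y v -> R (x ** y) (u + v)%Z) ->
  (forall x u, R x u -> R (x^-1) (- u)%Z) ->
  (forall u, R gone u -> u = 0%Z) ->
  is_subgroup G (fun x => exists u, R x u) /\
  exists f, zhom_on (fun x => exists u, R x u) f /\ forall x u, R x u -> f x = u.
Proof.
  intros R1 RM RV R0.
  assert (F : forall x u v, R x u -> R x v -> u = v).
  { intros x u v Hu Hv. assert (E := RM _ _ _ _ Hu (RV _ _ Hv)).
    rewrite gmulVr in E. apply R0 in E. lia. }
  split.
  - repeat split; [now exists 0%Z| |].
    + intros x y [u Hu] [v Hv]; eauto.
    + intros x [u Hu]; eauto.
  - exists (fun x => epsilon (inhabits 0%Z) (R x)).
    assert (K : forall x u, R x u -> epsilon (inhabits 0%Z) (R x) = u).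
    { intros x u Hu. apply (F x); auto. apply epsilon_spec. eauto. }
    split; auto. intros x y [u Hu] [v Hv]. now rewrite (K _ _ Hu), (K _ _ Hv), (K _ _ (RM _ _ _ _ Hu Hv)).
Qed.

(** The extension sends [s b^m] to [k f(s) + m l]; the condition on the powers of [b] in [S] makes
    this well defined. The factor [k] avoids divisibility problems. *)
Lemma zhom_adjoin B S b (f : G -> Z) k l :
  is_subgroup G B -> commuting B B -> is_subgroup G S -> (forall x, S x -> B x) -> B b ->
  zhom_on S f -> (forall m, S (gzpow G b m) -> (k * f (gzpow G b m) = m * l)%Z) ->
  exists S' f', is_subgroup G S' /\ (forall x, S' x -> B x) /\ (forall x, S x -> S' x) /\ S' b /\
    zhom_on S' f' /\ (forall x, S x -> f' x = k * f x)%Z /\ f' b = l.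
Proof.
  intros HB C HS SB Hb Hf Hk.
  pose (R := fun g (z : Z) => exists s m, S s /\ g = s ** gzpow G b m /\ (z = k * f s + m * l)%Z).
  assert (Hp : forall m, B (gzpow G b m)) by (intro; apply gzpow_in; auto).
  destruct (zhom_of_relation R) as (HS' & f' & Hf' & Ef').
  - exists gone, 0%Z. repeat split; [apply HS|simpl; now gsimp|]. rewrite (zhom_on_1 S); auto. lia.
  - intros x y u v (s & m & Hs & -> & ->) (s' & m' & Hs' & -> & ->).
    exists (s ** s'), (m + m')%Z. repeat split; [now apply HS| |rewrite Hf by auto; lia].
    rewrite gzpow_add, <- !gmulA. f_equal. rewrite !gmulA. f_equal. apply C; auto.
  - intros x u (s & m & Hs & -> & ->). exists (s^-1), (- m)%Z.
    repeat split; [now apply HS| |rewrite (zhom_on_inv S) by auto; lia].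
    rewrite gzpow_opp, ginvM. apply C; apply HB; auto.
  - intros u (s & m & Hs & E & ->).
    assert (Es : gzpow G b m = s^-1) by now apply ginv_unique.
    specialize (Hk m). rewrite Es in Hk. rewrite (zhom_on_inv S) in Hk by auto.
    rewrite <- Hk by now apply HS. lia.
  - exists (fun x => exists u, R x u), f'. repeat split; try apply HS'; auto.
    + intros x (u & s & m & Hs & -> & _). apply HB; auto.
    + intros x Hx. exists (k * f x)%Z, x, 0%Z. repeat split; auto; [simpl; now gsimp|lia].
    + exists l, gone, 1%Z. repeat split; [apply HS|now rewrite gzpow_1, gmul1|].
      rewrite (zhom_on_1 S) by auto. lia.
    + intros x Hx. apply Ef'. exists x, 0%Z. repeat split; auto; [simpl; now gsimp|lia].
    + apply Ef'. exists gone, 1%Z. repeat split; [apply HS|now rewrite gzpow_1, gmul1|].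
      rewrite (zhom_on_1 S) by auto. lia.
Qed.

(** Generators are adjoined one at a time. If [b^k] lies in [S] with [k > 0], then [f] is multiplied
    by [k] and [b] goes to [f(b^k)]; if no such power exists, [b] goes to 0. [N] is the product of
    the factors. *)
Lemma zhom_extend B S (f : G -> Z) :
  fgtf_abelian B -> is_subgroup G S -> (forall x, S x -> B x) -> zhom_on S f ->
  exists N f', (0 < N)%Z /\ zhom_on B f' /\ forall x, S x -> (f' x = N * f x)%Z.
Proof.
  intros [HB C (bs & Hbs & gen) _] HS SB Hf.
  assert (K : exists N S' f', (0 < N)%Z /\ is_subgroup G S' /\ (forall x, S' x -> B x) /\
    (forall x, S x -> S' x) /\ Forall S' bs /\ zhom_on S' f' /\ forall x, S x -> (f' x = N * f x)%Z).
  { clear gen. induction Hbs as [|b bs Hb _ IH].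
    - exists 1%Z, S, f. repeat split; auto; try apply HS; intros; lia.
    - destruct IH as (N & S1 & f1 & HN & HS1 & S1B & SS1 & Hbs & Hf1 & E1).
      assert (exists k l, (0 < k)%Z /\
        forall m, S1 (gzpow G b m) -> (k * f1 (gzpow G b m) = m * l)%Z) as (k & l & Hk & Hkl).
      { destruct (classic (exists k, (0 < k)%Z /\ S1 (gzpow G b k))) as [(k & Hk & Sk)|No].
        - exists k, (f1 (gzpow G b k)). split; auto. intros m Hm.
          assert (E : forall g n, S1 g -> f1 (gzpow G g n) = (n * f1 g)%Z).
          { intros g n Hg. revert n. apply Z.bi_induction.
            - now intros ? ? ->.
            - simpl. rewrite (zhom_on_1 S1); auto.
            - intros n. rewrite gzpow_succ, Hf1; auto; [|now apply gzpow_in]. lia. }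
          (* Both sides are the value of [f1] at [b^(k m)]. *)
          rewrite <- !E by auto. rewrite <- !gzpow_mul. f_equal. f_equal. lia.
        - exists 1%Z, 0%Z. split; [lia|]. intros m Hm.
          destruct (Z.lt_trichotomy m 0) as [Hlt|[->|Hgt]].
          + exfalso. apply No. exists (- m)%Z. split; [lia|]. rewrite gzpow_opp. now apply HS1.
          + simpl. rewrite (zhom_on_1 S1); auto.
          + exfalso. apply No. exists m. split; [lia|auto]. }
      destruct (zhom_adjoin B S1 b f1 k l) as (S2 & f2 & HS2 & S2B & S12 & Sb & Hf2 & E2 & _); auto.
      exists (k * N)%Z, S2, f2. split; [lia|]. do 3 (split; [auto|]).
      split; [|split; [auto|]].
      + constructor; auto. eapply Forall_impl; [|exact Hbs]; auto.
      + intros x Hx. rewrite E2, E1 by auto. lia. }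
  destruct K as (N & S' & f' & HN & HS' & S'B & SS' & Hb' & Hf' & E).
  exists N, f'. repeat split; auto. intros x y Hx Hy. apply Hf'; apply (gen S'); auto.
Qed.

(** Since [f] vanishes on the intersection of [A] and [P], it factors through [a p -> f(a)] on the
    product [A P], which is then extended to [B]. *)
Lemma zhom_extend_kill B A P (f : G -> Z) :
  fgtf_abelian B -> is_subgroup G A -> is_subgroup G P -> (forall x, A x -> B x) -> (forall x, P x -> B x) ->
  zhom_on A f -> (forall x, A x -> P x -> f x = 0%Z) ->
  exists N f', (0 < N)%Z /\ zhom_on B f' /\ (forall x, A x -> (f' x = N * f x)%Z) /\
    (forall x, P x -> f' x = 0%Z).
Proof.
  intros HB HA HP AB PB Hf K0.
  pose (R := fun g (z : Z) => exists a p, A a /\ P p /\ g = a ** p /\ z = f a).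
  destruct (zhom_of_relation R) as (HS & f1 & Hf1 & E1).
  - exists gone, gone. repeat split; [apply HA|apply HP|now gsimp|].
    symmetry. now apply (zhom_on_1 A).
  - intros x y u v (a & p & Ha & Hp & -> & ->) (a' & p' & Ha' & Hp' & -> & ->).
    exists (a ** a'), (p ** p'). repeat split; [now apply HA|now apply HP| |now rewrite Hf].
    rewrite <- !gmulA. f_equal. rewrite !gmulA. f_equal. apply HB; auto.
  - intros x u (a & p & Ha & Hp & -> & ->). exists (a^-1), (p^-1).
    repeat split; [now apply HA|now apply HP| |symmetry; now apply (zhom_on_inv A)].
    rewrite ginvM. apply HB; apply (fgtf_sub _ HB); auto.
  - intros u (a & p & Ha & Hp & E & ->). symmetry in E. apply ginv_unique in E. subst p.
    apply K0; auto. rewrite <- (ginvK a). now apply HP.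
  - destruct (zhom_extend B (fun x => exists u, R x u) f1) as (N & f2 & HN & Hf2 & E2); auto.
    + intros x (u & a & p & Ha & Hp & -> & _). apply (fgtf_sub _ HB); auto.
    + assert (RA : forall x, A x -> R x (f x)).
      { intros x Hx. exists x, gone. repeat split; auto; [apply HP|now gsimp]. }
      assert (RP : forall x, P x -> R x 0%Z).
      { intros x Hx. exists gone, x. repeat split; auto; [apply HA|now gsimp|].
        symmetry. now apply (zhom_on_1 A). }
      exists N, f2. repeat split; auto.
      * intros x Hx. rewrite E2, (E1 x (f x)); eauto.
      * intros x Hx. rewrite E2, (E1 x 0%Z); eauto. lia.
Qed.

(** Write [x = a c] with [c] in the complement: then [c^n] lies in both factors, so it is trivial,
    and [c = 1] by torsion-freeness. *)
Lemma direct_factor_pure A B x n :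
  fgtf_abelian B -> direct_factor G A B -> B x -> n <> 0%Z -> A (gzpow G x n) -> A x.
Proof.
  intros HB (HA & _ & AB & C & HC & CB & _ & _ & T & Dec) Hx Hn Hxn.
  destruct (Dec x Hx) as (a & c & Ha & Hc & ->).
  assert (Cc : C (gzpow G c n)) by now apply gzpow_in.
  assert (gzpow G c n = gone).
  { apply T; auto. rewrite gzpow_mulg in Hxn by (apply HB; auto).
    rewrite <- (gmulK (gzpow G a n) (gzpow G c n)).
    apply HA; auto. apply HA. now apply gzpow_in. }
  assert (c = gone) as -> by (apply (fgtf_tf _ HB c n); auto).
  now rewrite gmul1r.
Qed.

(** By purity no nontrivial power of [x] lies in [A], so killing [A] and sending [x] to 1 is
    consistent. Extending to [B] multiplies by a positive integer only. *)
Lemma zhom_separate A B x :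
  fgtf_abelian B -> direct_factor G A B -> B x -> ~ A x ->
  exists f, zhom_on B f /\ (forall a, A a -> f a = 0%Z) /\ f x <> 0%Z.
Proof.
  intros HB HAB Hx Nx.
  assert (HA : is_subgroup G A) by apply HAB.
  assert (AB : forall a, A a -> B a) by apply HAB.
  destruct (zhom_adjoin B A x (fun _ => 0%Z) 1 1) as (S & f & HS & SB & AS & Sx & Hf & E0 & E1); auto;
    try apply HB.
  - intros ? ? _ _. reflexivity.
  - intros m Hm. destruct (Z.eq_dec m 0) as [->|Hm0]; [reflexivity|].
    exfalso. apply Nx. now apply (direct_factor_pure A B x m).
  - destruct (zhom_extend B S f) as (N & f' & HN & Hf' & E); auto.
    exists f'. split; auto. split.
    + intros a Ha. rewrite E, E0 by auto. lia.
    + rewrite E, E1 by auto. lia.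
Qed.

(** The retraction is the projection along the complement; the [A]-component is unique because the
    factors meet trivially. *)
Lemma direct_factor_retract A B :
  commuting B B -> direct_factor G A B ->
  exists r : G -> G, hom_on B r /\ (forall x, B x -> A (r x)) /\ (forall x, A x -> r x = x).
Proof.
  intros HB (HA & HBs & AB & C & HC & CB & _ & _ & T & Dec).
  assert (U : forall a a' c c', A a -> A a' -> C c -> C c' -> a ** c = a' ** c' -> a = a').
  { intros a a' c c' Ha Ha' Hc Hc' E.
    assert (E' : a'^-1 ** a = c' ** c^-1).
    { apply (gcancel a'). rewrite gmulVK, gmulA, <- E. now gsimp. }
    apply (gcancel (a'^-1)). rewrite gmulV. apply T.
    - apply HA; auto. now apply HA.
    - rewrite E'. apply HC; auto. now apply HC. }
  exists (fun x => epsilon (inhabits gone) (fun a => A a /\ exists c, C c /\ x = a ** c)).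
  assert (K : forall x, B x -> A (epsilon (inhabits gone) (fun a => A a /\ exists c, C c /\ x = a ** c)) /\
     exists c, C c /\ x = epsilon (inhabits gone) (fun a => A a /\ exists c, C c /\ x = a ** c) ** c).
  { intros x Hx. apply epsilon_spec. destruct (Dec x Hx) as (a & c & Ha & Hc & E). exists a; eauto. }
  repeat split.
  - intros x y Hx Hy. destruct (K x Hx) as (Ax & cx & Cx & Ex), (K y Hy) as (Ay & cy & Cy & Ey).
    destruct (K (x ** y)) as (Axy & cxy & Cxy & Exy); [now apply HBs|].
    set (rx := epsilon _ (fun a => A a /\ exists c, C c /\ x = a ** c)) in *.
    set (ry := epsilon _ (fun a => A a /\ exists c, C c /\ y = a ** c)) in *.
    set (rxy := epsilon _ _) in *.
    apply (U _ _ cxy (cx ** cy)); auto; try (now apply HA); try (now apply HC).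
    rewrite <- Exy, Ex, Ey, <- !gmulA. f_equal. rewrite !gmulA. f_equal. apply HB; auto.
  - intros x Hx. now apply K.
  - intros x Hx. destruct (K x (AB x Hx)) as (Ax & c & Cc & Ex).
    apply (U _ _ c gone); auto; [apply HC|]. now rewrite <- Ex, gmul1r.
Qed.
End Subgroups.

(** [n] is the positive generator of the subgroup of Z generated by [X]. The last clause says that
    the values divided by [n] generate Z. *)
Lemma zvalues_normalise (X : Z -> Prop) z0 :
  X z0 -> z0 <> 0%Z ->
  exists n, (0 < n)%Z /\ (forall z, X z -> exists w, z = n * w)%Z /\
   forall W : Z -> Prop, W 0%Z -> (forall u v, W u -> W v -> W (u + v)%Z) -> (forall u, W u -> W (- u)%Z) ->
    (forall w, X (n * w)%Z -> W w) -> W 1%Z.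
Proof.
  intros Xz0 Hz0.
  pose (Gen := fun z => forall W : Z -> Prop, W 0%Z -> (forall u v, W u -> W v -> W (u + v)%Z) ->
    (forall u, W u -> W (- u)%Z) -> (forall w, X w -> W w) -> W z).
  assert (G0 : Gen 0%Z) by (intros W W0 WM WV WX; auto).
  assert (GM : forall u v, Gen u -> Gen v -> Gen (u + v)%Z) by (intros u v Hu Hv W W0 WM WV WX; apply WM; [apply Hu|apply Hv]; auto).
  assert (GV : forall u, Gen u -> Gen (- u)%Z) by (intros u Hu W W0 WM WV WX; apply WV; apply Hu; auto).
  assert (GX : forall u, X u -> Gen u) by (intros u Hu W W0 WM WV WX; auto).
  assert (Gmul : forall k u, Gen u -> Gen (k * u)%Z).
  { intros k u Hu. revert k. apply Z.bi_induction.
    - now intros ? ? ->.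
    - exact G0.
    - intros n. rewrite Z.mul_succ_l. split; intros H; [now apply GM|].
      replace (n * u)%Z with (n * u + u + - u)%Z by lia. apply GM; auto. }
  destruct (dec_inh_nat_subset_has_unique_least_element (fun k => (0 < k)%nat /\ Gen (Z.of_nat k)))
    as (n & ((Hn & Gn) & Hmin) & _).
  - intros k. apply classic.
  - exists (Z.abs_nat z0). split; [lia|]. rewrite Zabs2Nat.id_abs.
    destruct (Z.abs_eq_or_opp z0) as [-> | ->]; auto.
  - assert (Div : forall z, Gen z -> exists w, z = (Z.of_nat n * w)%Z).
    { intros z Hz. exists (z / Z.of_nat n)%Z.
      assert (Dm := Z.div_mod z (Z.of_nat n)). assert (Bd := Z.mod_pos_bound z (Z.of_nat n)).
      destruct (Z.eq_dec (z mod Z.of_nat n) 0) as [E|E]; [lia|]. exfalso.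
      assert (n <= Z.to_nat (z mod Z.of_nat n)); [|lia].
      apply Hmin. split; [lia|]. rewrite Z2Nat.id by lia.
      replace (z mod Z.of_nat n)%Z with (z + - (z / Z.of_nat n * Z.of_nat n))%Z by lia.
      apply GM, GV, Gmul; auto. }
    exists (Z.of_nat n). repeat split; [lia|auto|].
    intros W W0 WM WV WX.
    (* [n] lies in every subgroup containing [X], in particular in [n W]; cancelling [n] puts 1 in
       [W]. *)
    assert (exists w, Z.of_nat n = (Z.of_nat n * w)%Z /\ W w) as (w & Ew & Hw).
    { apply (Gn (fun z => exists w, z = (Z.of_nat n * w)%Z /\ W w)).
      - exists 0%Z. split; [lia|auto].
      - intros u v (w & -> & ?) (w' & -> & ?). exists (w + w')%Z. split; [lia|auto].
      - intros u (w & -> & ?). exists (- w)%Z. split; [lia|auto].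
      - intros u Hu. destruct (Div u) as [w ->]; auto. exists w; auto. }
    assert (w = 1%Z) as -> by nia. exact Hw.
Qed.

(** * The free group on two letters *)

Definition flip (l : letter) : letter := (fst l, negb (snd l)).

Lemma cancel_spec (l m : letter) :
  Bool.eqb (fst m) (fst l) && Bool.eqb (snd m) (negb (snd l)) = true <-> m = flip l.
Proof.
  destruct l as [[] []], m as [[] []]; simpl; split; intros H; try discriminate; auto.
Qed.

Lemma reduced_cons l m w : reduced_word (l :: m :: w) <-> m <> flip l /\ reduced_word (m :: w).
Proof.
  cbn [reduced_word]. destruct l as [a s], m as [b t]. simpl. unfold flip. simpl.
  split; intros [H1 H2]; split; auto.
  - intros E. injection E as -> ->. tauto.
  - intros [-> ->]. tauto.
Qed.

Lemma cons_red_cases l w :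
  (exists w', w = flip l :: w' /\ cons_red l w = w') \/
  (cons_red l w = l :: w /\ forall m w', w = m :: w' -> m <> flip l).
Proof.
  destruct w as [|m w]; simpl; [right; split; [auto|discriminate]|].
  destruct (Bool.eqb _ _ && _) eqn:E.
  - apply cancel_spec in E as ->. left; eauto.
  - right. split; auto. intros m' w' Ew Em. injection Ew as <- _.
    apply cancel_spec in Em. congruence.
Qed.

Lemma reduced_tail l w : reduced_word (l :: w) -> reduced_word w.
Proof. destruct w; [simpl; auto|]. now intros [_ H]%reduced_cons. Qed.

Lemma cons_red_reduced l w : reduced_word w -> reduced_word (cons_red l w).
Proof.
  intros Hw. destruct (cons_red_cases l w) as [(w' & -> & ->)|(-> & H)].
  - now apply reduced_tail in Hw.
  - destruct w as [|m w]; [simpl; auto|]. apply reduced_cons. eauto.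
Qed.

Lemma cons_red_of_reduced l w : reduced_word (l :: w) -> cons_red l w = l :: w.
Proof.
  intros H. destruct (cons_red_cases l w) as [(w' & -> & _)|(-> & _)]; auto.
  apply reduced_cons in H. tauto.
Qed.

Lemma flipK l : flip (flip l) = l.
Proof. destruct l as [a []]; reflexivity. Qed.

(** On reduced words a letter and its inverse act by mutually inverse permutations, as in van der
    Waerden's construction; associativity of [f2mul] rests on this. *)
Lemma cons_red_flip l w : reduced_word w -> cons_red (flip l) (cons_red l w) = w.
Proof.
  intros Hw. destruct (cons_red_cases l w) as [(w' & -> & ->)|(-> & H)].
  - now apply cons_red_of_reduced.
  - destruct (cons_red_cases (flip l) (l :: w)) as [(w' & E & ->)|(_ & K)].
    + now injection E.
    + exfalso. apply (K l w); auto. now rewrite flipK.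
Qed.

Lemma f2mul_reduced u v : reduced_word v -> reduced_word (f2mul u v).
Proof. intros Hv. induction u; simpl; auto. now apply cons_red_reduced. Qed.

Lemma f2mul_cons_red l u v : reduced_word v -> f2mul (cons_red l u) v = cons_red l (f2mul u v).
Proof.
  intros Hv. destruct (cons_red_cases l u) as [(w' & -> & ->)|(-> & _)]; auto.
  simpl. assert (E := cons_red_flip (flip l) (f2mul w' v)). rewrite flipK in E.
  symmetry. apply E. now apply f2mul_reduced.
Qed.

Lemma f2mulA u v w : reduced_word w -> f2mul u (f2mul v w) = f2mul (f2mul u v) w.
Proof. intros Hw. induction u; simpl; auto. rewrite f2mul_cons_red; congruence. Qed.

Lemma f2mul_nil u : reduced_word u -> f2mul u [] = u.
Proof.
  induction u as [|l u IH]; simpl; auto. intros H.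
  change (fold_right cons_red [] u) with (f2mul u []).
  rewrite IH by now apply reduced_tail in H. now apply cons_red_of_reduced.
Qed.

Fixpoint f2inv (u : list letter) : list letter :=
  match u with
  | [] => []
  | l :: u' => f2mul (f2inv u') [flip l]
  end.

Lemma f2inv_reduced u : reduced_word (f2inv u).
Proof. destruct u; simpl; auto. now apply f2mul_reduced. Qed.

Lemma f2mul_inv u : reduced_word u -> f2mul (f2inv u) u = [].
Proof.
  intros Hu. rewrite <- (f2mul_nil u Hu) at 2. clear Hu.
  induction u as [|l u IH]; simpl; auto.
  change (fold_right cons_red [] u) with (f2mul u []).
  assert (Hz : reduced_word (f2mul u [])) by (apply f2mul_reduced; simpl; auto).
  rewrite <- f2mulA by now apply cons_red_reduced.
  change (f2mul [flip l] (cons_red l (f2mul u []))) with (cons_red (flip l) (cons_red l (f2mul u []))).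
  now rewrite cons_red_flip.
Qed.

Definition F2car := {w : list letter | reduced_word w}.

Lemma F2car_eq (u v : F2car) : proj1_sig u = proj1_sig v -> u = v.
Proof. apply eq_sig_hprop. intros; apply proof_irrelevance. Qed.

Definition F2mul (u v : F2car) : F2car :=
  exist _ (f2mul (proj1_sig u) (proj1_sig v)) (f2mul_reduced _ _ (proj2_sig v)).

Definition F2 : group.
Proof.
  refine (Group F2car F2mul (fun u => exist _ (f2inv (proj1_sig u)) (f2inv_reduced _))
    (exist _ [] I) _ _ _).
  - intros x y z. apply F2car_eq. simpl. apply f2mulA. apply proj2_sig.
  - intros x. now apply F2car_eq.
  - intros x. apply F2car_eq. simpl. apply f2mul_inv. apply proj2_sig.
Defined.

Definition F2letter (b : bool) : F2 := exist _ [(b, true)] I.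

Lemma maps_onto_F2_of_hom (G : group) (f : G -> F2) :
  (forall x y, f (x ** y) = f x ** f y) ->
  (forall b, exists g, f g = F2letter b) -> maps_onto_F2 G.
Proof.
  intros Hf Hb. exists (fun g => proj1_sig (f g)).
  assert (T : is_subgroup G (fun _ => True)) by (repeat split).
  assert (Hf' : hom_on (fun _ => True) f) by (intros x y _ _; apply Hf).
  assert (Hl : forall l, exists g, proj1_sig (f g) = [l]).
  { intros [b s]. destruct (Hb b) as [g Hg]. destruct s.
    - exists g. now rewrite Hg.
    - exists (g^-1). rewrite (hom_on_inv (fun _ => True)) by auto. rewrite Hg. reflexivity. }
  split; [|split].
  - intros g. apply proj2_sig.
  - intros g h. now rewrite Hf.
  - induction w as [|l w IH]; intros Hw.
    + exists gone. now rewrite (hom_on_1 (fun _ => True)) by auto.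
    + destruct (Hl l) as [g Hg], IH as [h Hh]; [now apply reduced_tail in Hw|].
      exists (g ** h). rewrite Hf. simpl. rewrite Hg, Hh. now apply cons_red_of_reduced.
Qed.

(** * Trees rooted at a vertex *)

Section Walks.
Context {V E : Type} (src tgt : E -> V).

Definition joins (e : E) (u w : V) : Prop := (src e = u /\ tgt e = w) \/ (src e = w /\ tgt e = u).

Lemma joins_sym e u w : joins e u w -> joins e w u.
Proof. unfold joins. tauto. Qed.

Lemma walk_app x p q y : walk V E src tgt x (p ++ q) y <->
  exists z, walk V E src tgt x p z /\ walk V E src tgt z q y.
Proof.
  revert x. induction p as [|[e b] p IH]; intros x; simpl.
  - split; [intros H; eauto|intros (z & -> & H); auto].
  - rewrite IH. split; [intros (H & z & ?); exists z; tauto|intros (z & (? & ?) & ?)]; eauto.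
Qed.

Definition rev_walk (p : list (E * bool)) : list (E * bool) :=
  map (fun q => (fst q, negb (snd q))) (rev p).

Lemma walk_rev x p y : walk V E src tgt x p y -> walk V E src tgt y (rev_walk p) x.
Proof.
  revert x. induction p as [|[e b] p IH]; intros x; simpl; auto.
  intros [H1 H2]. unfold rev_walk. simpl. rewrite map_app. apply walk_app.
  exists (oend V E src tgt e b). split; [now apply IH|].
  simpl. destruct b; simpl in *; auto.
Qed.

Definition backtrack (e f : E * bool) := fst e = fst f /\ snd f = negb (snd e).

Lemma reduced_path_app p q :
  reduced_path E (p ++ q) <-> reduced_path E p /\ reduced_path E q /\
   forall e f p' q', p = p' ++ [e] -> q = f :: q' -> ~ backtrack e f.
Proof.
  induction p as [|[e b] p IH].
  - simpl. split; [|tauto]. intros H. repeat split; auto. intros. destruct p'; discriminate.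
  - destruct p as [|[e1 b1] p].
    + destruct q as [|[f c] q]; simpl.
      * split; [|tauto]. intros _. repeat split; auto. discriminate.
      * split.
        -- intros [H1 H2]. repeat split; auto. intros e0 f0 p' q' E1 E2 [K1 K2].
           destruct p' as [|? [|]]; try discriminate. simpl in *. injection E1 as <-. injection E2 as <- <-.
           simpl in *. apply H1. auto.
        -- intros (_ & H2 & H3). split; auto. intros [-> ->].
           apply (H3 (f, b) (f, negb b) [] q); auto. split; auto.
    + change (reduced_path E (((e, b) :: (e1, b1) :: p) ++ q)) with
        (~ (e = e1 /\ b1 = negb b) /\ reduced_path E (((e1, b1) :: p) ++ q)).
      change (reduced_path E ((e, b) :: (e1, b1) :: p)) with
        (~ (e = e1 /\ b1 = negb b) /\ reduced_path E ((e1, b1) :: p)).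
      rewrite IH. split.
      * intros (H1 & H2 & H3 & H4). repeat split; auto.
        intros e0 f0 p' q' E1 E2. destruct p' as [|x p']; [discriminate|].
        injection E1 as _ E1. eapply H4; eauto.
      * intros ((H1 & H2) & H3 & H4). repeat split; auto.
        intros e0 f0 p' q' E1 E2. apply (H4 e0 f0 ((e, b) :: p') q'); auto. simpl. now rewrite E1.
Qed.

Lemma reduced_path_rev p : reduced_path E p -> reduced_path E (rev_walk p).
Proof.
  induction p as [|[e b] p IH]; [auto|].
  change ((e, b) :: p) with ([(e, b)] ++ p). unfold rev_walk in *. rewrite rev_app_distr, map_app.
  intros H. apply reduced_path_app in H as (_ & H2 & H3). apply reduced_path_app.
  repeat split; [auto|].
  intros e0 f0 p' q' E1 E2 [K1 K2]. simpl in E2. injection E2 as <- <-.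
  destruct p as [|f p]; [destruct p'; discriminate|].
  simpl in E1. rewrite map_app in E1. simpl in E1. apply app_inj_tail in E1 as [_ <-].
  apply (H3 (e, b) f [] p); auto. simpl in *.
  split; simpl; auto. destruct b, (snd f); simpl in *; congruence.
Qed.

Section Root.
Context (tree : is_tree V E src tgt) (r : V).
Let W := walk V E src tgt.

Definition has_len (v : V) (n : nat) := exists p, W r p v /\ length p = n.

Lemma shortest_exists v : exists n, has_len v n /\ forall m, has_len v m -> n <= m.
Proof.
  destruct (dec_inh_nat_subset_has_unique_least_element (has_len v)) as (n & H & _); eauto.
  - intros; apply classic.
  - destruct tree as (_ & C & _). destruct (C r v) as [p Hp]. exists (length p), p; auto.
Qed.

Definition dist (v : V) : nat := epsilon (inhabits 0) (fun n => has_len v n /\ forall m, has_len v m -> n <= m).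

Lemma dist_spec v : has_len v (dist v) /\ forall m, has_len v m -> dist v <= m.
Proof. unfold dist. apply epsilon_spec. apply shortest_exists. Qed.

(** If the last edge undid the one before it, dropping both would give a shorter walk. *)
Lemma shortest_reduced p v : W r p v -> length p = dist v -> reduced_path E p.
Proof.
  revert v. induction p as [|q p IH] using rev_ind; intros v Hp Hl; [simpl; auto|].
  apply walk_app in Hp as Hp'. destruct Hp' as (z & Hz & Hq).
  destruct (dist_spec v) as [_ Min].
  assert (Hlz : length p = dist z).
  { destruct (dist_spec z) as [(p' & Hp' & Lp') Mz].
    assert (dist z <= length p) by (apply Mz; exists p; auto).
    assert (dist v <= length (p' ++ [q])).
    { apply Min. exists (p' ++ [q]). split; auto. apply walk_app; eauto. }
    rewrite length_app in *. simpl in *. lia. }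
  apply reduced_path_app. split; [eauto|]. split; [destruct q; simpl; auto|].
  intros e f p' q' -> Eq [K1 K2]. injection Eq as -> <-.
  apply walk_app in Hz as (y & Hy & He).
  assert (y = v).
  { destruct e as [e b], f as [f c]. simpl in *. subst. destruct He as [<- He], Hq as [<- Hq].
    destruct b; simpl in *; auto. }
  subst y. assert (dist v <= length p') by (apply Min; exists p'; auto).
  rewrite !length_app in Hl. simpl in Hl. lia.
Qed.

Lemma dist_step e b : dist (oend V E src tgt e b) <= S (dist (ostart V E src tgt e b)).
Proof.
  destruct (dist_spec (ostart V E src tgt e b)) as [(p & Hp & <-) _].
  apply dist_spec. exists (p ++ [(e, b)]). split; [|rewrite length_app; simpl; lia].
  apply walk_app. exists (ostart V E src tgt e b). split; simpl; auto.
Qed.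

Lemma shortest_last e b p v : W r p v -> length p = dist v ->
  (exists p', p = p' ++ [(e, b)]) -> dist v = S (dist (ostart V E src tgt e b)) /\ oend V E src tgt e b = v.
Proof.
  intros Hp Hl (p' & ->). apply walk_app in Hp as (z & Hz & Hq). simpl in Hq. destruct Hq as [<- <-].
  split; auto. rewrite length_app in Hl. simpl in Hl.
  assert (dist (ostart V E src tgt e b) <= length p') by (apply dist_spec; exists p'; auto).
  assert (Hs := dist_step e b). lia.
Qed.

(** Were the distances equal, a shortest walk to one end, the edge, and a reversed shortest walk
    from the other end would form a closed reduced walk: a backtrack at a junction makes the
    distances differ by one. *)
Lemma dist_ne e b : dist (oend V E src tgt e b) <> dist (ostart V E src tgt e b).
Proof.
  intros Heq. destruct tree as (_ & _ & NC).
  destruct (dist_spec (ostart V E src tgt e b)) as [(p & Hp & Lp) _].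
  destruct (dist_spec (oend V E src tgt e b)) as [(q & Hq & Lq) _].
  apply (NC r (p ++ [(e, b)] ++ rev_walk q)).
  - destruct p; discriminate.
  - apply walk_app. exists (ostart V E src tgt e b). split; auto.
    simpl. split; auto. now apply walk_rev.
  - apply reduced_path_app. split; [now apply shortest_reduced with (ostart V E src tgt e b)|]. split.
    + apply reduced_path_app. split; [simpl; auto|]. split.
      * apply reduced_path_rev. now apply shortest_reduced with (oend V E src tgt e b).
      * intros e0 f p' q' E1 E2 [K1 K2]. destruct p' as [|? [|]]; try discriminate. injection E1 as <-.
        destruct q as [|[f' c] q _] using rev_ind; [discriminate|].
        unfold rev_walk in E2. rewrite rev_app_distr in E2. simpl in E2. injection E2 as <- <-.
        simpl in *. subst f'.
        assert (c = b) as -> by (destruct b, c; simpl in *; congruence).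
        destruct (shortest_last e b _ _ Hq Lq) as [K _]; eauto. lia.
    + intros e0 f p' q' -> E2 [K1 K2]. injection E2 as <- <-. destruct e0 as [e0 c]. simpl in *. subst e0.
      destruct (shortest_last e c _ _ Hp Lp) as [K K']; eauto.
      subst b. destruct c; simpl in *; lia.
Qed.

(** Two distinct edges leading down from one vertex, prolonged by shortest walks to the root, would
    give a closed reduced walk. *)
Lemma lower_edge_unique e b f c : oend V E src tgt e b = oend V E src tgt f c ->
  dist (oend V E src tgt e b) = S (dist (ostart V E src tgt e b)) ->
  dist (oend V E src tgt f c) = S (dist (ostart V E src tgt f c)) -> (e, b) = (f, c).
Proof.
  intros Hend D1 D2. apply NNPP. intros Hne. destruct tree as (_ & _ & NC).
  destruct (dist_spec (ostart V E src tgt e b)) as [(p & Hp & Lp) _].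
  destruct (dist_spec (ostart V E src tgt f c)) as [(q & Hq & Lq) _].
  assert (Hp' : W r (p ++ [(e, b)]) (oend V E src tgt e b)) by (apply walk_app; exists (ostart V E src tgt e b); simpl; auto).
  assert (Hq' : W r (q ++ [(f, c)]) (oend V E src tgt f c)) by (apply walk_app; exists (ostart V E src tgt f c); simpl; auto).
  apply (NC r ((p ++ [(e, b)]) ++ rev_walk (q ++ [(f, c)]))).
  - destruct p; discriminate.
  - apply walk_app. exists (oend V E src tgt e b). split; auto. apply walk_rev. now rewrite Hend.
  - apply reduced_path_app. split; [|split].
    + eapply shortest_reduced; eauto. rewrite length_app; simpl; lia.
    + apply reduced_path_rev. eapply shortest_reduced; eauto. rewrite length_app; simpl; lia.
    + intros e0 f0 p' q' E1 E2 [K1 K2]. apply app_inj_tail in E1 as [_ <-].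
      unfold rev_walk in E2. rewrite rev_app_distr in E2. simpl in E2. injection E2 as <- _.
      simpl in *. apply Hne. f_equal; auto. destruct b, c; simpl in *; congruence.
Qed.

Lemma joins_orient e u w : joins e u w -> exists b, u = ostart V E src tgt e b /\ w = oend V E src tgt e b.
Proof. intros [[<- <-]|[<- <-]]; [exists true|exists false]; auto. Qed.

Lemma joins_lower e u w : joins e u w -> dist w = S (dist u) \/ dist u = S (dist w).
Proof.
  intros (b & -> & ->)%joins_orient.
  assert (H1 := dist_step e b). assert (H2 := dist_ne e b). assert (H3 := dist_step e (negb b)).
  destruct b; simpl in *; lia.
Qed.

Lemma edge_unique e e' u w : joins e u w -> joins e' u w -> e = e'.
Proof.
  enough (K : forall u w, dist w = S (dist u) -> joins e u w -> joins e' u w -> e = e').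
  { intros H H'. destruct (joins_lower e u w H); [now apply (K u w)|].
    apply (K w u); auto; now apply joins_sym. }
  clear u w. intros u w D (b & -> & Ew)%joins_orient (c & Eu' & Ew')%joins_orient.
  subst w. enough ((e, b) = (e', c)) by congruence.
  apply lower_edge_unique; auto. rewrite <- Ew', D. congruence.
Qed.

Lemma lower_unique e e' u u' v : joins e u v -> joins e' u' v ->
  dist v = S (dist u) -> dist v = S (dist u') -> u = u'.
Proof.
  intros (b & -> & ->)%joins_orient (c & -> & Ew')%joins_orient D1 D2.
  assert ((e, b) = (e', c)) as K by (apply lower_edge_unique; auto; congruence).
  now injection K as -> ->.
Qed.

Lemma dist_0 v : dist v = 0 <-> v = r.
Proof.
  split.
  - destruct (dist_spec v) as [([|] & Hp & Lp) _]; intros H; [now simpl in Hp|]. simpl in Lp. lia.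
  - intros ->. assert (dist r <= 0); [|lia]. apply dist_spec. exists []. split; reflexivity.
Qed.

Lemma lower_exists v : v <> r -> exists e u, joins e u v /\ dist v = S (dist u).
Proof.
  intros Hv. destruct (dist_spec v) as [(p & Hp & Lp) _].
  destruct p as [|[e b] p _] using rev_ind; [now simpl in Hp; subst|].
  destruct (shortest_last e b _ _ Hp Lp) as [D <-]; eauto.
  exists e, (ostart V E src tgt e b). split; auto. destruct b; [left|right]; auto.
Qed.
End Root.
End Walks.

(** The form in which the tree enters the group-theoretic arguments: every adjacency joins a vertex
    to its parent, so claims go by induction on depth. *)
Record rooted {V : Type} (adj : V -> V -> Prop) (r : V) := Rooted {
  dep : V -> nat;
  par : V -> V;
  dep_root : dep r = 0;
  dep_par : forall v, v <> r -> dep v = S (dep (par v));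
  par_adj : forall v, v <> r -> adj (par v) v;
  adj_par : forall u w, adj u w -> (w <> r /\ par w = u) \/ (u <> r /\ par u = w)
}.

Definition adjacent {V : Type} (arc : V -> V -> Prop) (u w : V) : Prop := arc u w \/ arc w u.

Lemma tree_rooted {V E : Type} (src tgt : E -> V) (r : V) :
  is_tree V E src tgt -> inhabited (rooted (adjacent (fun u w => exists e, src e = u /\ tgt e = w)) r).
Proof.
  intros tree. pose (d := dist src tgt r).
  set (adj := adjacent _).
  assert (Hadj : forall u w, adj u w <-> exists e, joins src tgt e u w).
  { intros u w. split; [intros [[e H]|[e H]]; exists e; red; tauto|].
    intros [e [H|H]]; [left|right]; eauto. }
  pose (P := fun v u => adj u v /\ d v = S (d u)).
  assert (HP : forall v, v <> r -> P v (epsilon (inhabits r) (P v))).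
  { intros v Hv. apply epsilon_spec. destruct (lower_exists src tgt tree r v Hv) as (e & u & H & D).
    exists u. split; [apply Hadj|]; eauto. }
  constructor. apply (Rooted V _ r d (fun v => epsilon (inhabits r) (P v))).
  - now apply dist_0.
  - intros v Hv. now apply HP.
  - intros v Hv. now apply HP.
  - assert (K : forall u w e, joins src tgt e u w -> d w = S (d u) -> w <> r /\ epsilon (inhabits r) (P w) = u).
    { intros u w e He D.
      assert (Hw : w <> r) by (intros Hw; apply (dist_0 src tgt tree) in Hw; unfold d in D; lia).
      split; auto. destruct (HP w Hw) as [He' D']. apply Hadj in He' as [e' He'].
      now apply (lower_unique src tgt tree r e' e _ _ w). }
    intros u w [e He]%Hadj. destruct (joins_lower src tgt tree r e u w He) as [D|D].
    + left. eapply K; eauto.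
    + right. apply (K w u e); auto. now apply joins_sym.
Qed.

Arguments dep {V adj r}.
Arguments par {V adj r}.

(** * Group actions on trees *)

Section Action.
Context {G : group} {V : Type} (act : G -> V -> V) (arc : V -> V -> Prop).
Notation adj := (adjacent arc).

(** Edges are recorded by their ordered pairs of ends, which determine them in a tree. *)
Record arc_action : Prop := ArcAction {
  act1 : forall v, act gone v = v;
  actM : forall g h v, act (g ** h) v = act g (act h v);
  arc_act : forall g u w, arc u w -> arc (act g u) (act g w);
  arc_anti : forall u w, arc u w -> arc w u -> False
}.

Context (HA : arc_action).

Lemma actK g v : act (g^-1) (act g v) = v.
Proof. now rewrite <- actM, gmulV, act1. Qed.

Lemma actVK g v : act g (act (g^-1) v) = v.
Proof. now rewrite <- actM, gmulVr, act1. Qed.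

Lemma adj_act g u w : adj u w -> adj (act g u) (act g w).
Proof. intros [H|H]; [left|right]; now apply arc_act. Qed.

Lemma adj_sym u w : adj u w -> adj w u.
Proof. unfold adjacent. tauto. Qed.

Definition stab (v : V) (g : G) : Prop := act g v = v.

Lemma stab_subgroup v : is_subgroup G (stab v).
Proof.
  unfold stab. repeat split.
  - now apply act1.
  - intros x y Hx Hy. now rewrite actM, Hy, Hx.
  - intros x Hx. rewrite <- Hx at 1. apply actK.
Qed.

Lemma stab_conj g v x : stab (act g v) x <-> stab v (g^-1 ** x ** g).
Proof.
  unfold stab. rewrite !actM by auto. split.
  - intros ->. apply actK.
  - intros H. rewrite <- H at 2. now rewrite actVK.
Qed.

Lemma act_eq_stab g h v : act g v = act h v -> stab v (h^-1 ** g).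
Proof. intros H. unfold stab. rewrite actM, H by auto. apply actK. Qed.

(** * Subtrees that meet every orbit once *)

Section Root.
Context {r : V} (T : rooted adj r).

Definition pclosed (D : V -> Prop) : Prop := D r /\ forall v, D v -> v <> r -> D (par T v).
Definition ptransversal (D : V -> Prop) : Prop := forall g v, D v -> D (act g v) -> act g v = v.
(** A subtree containing the root, with exactly one vertex from each orbit: a lift of a maximal
    subtree of the quotient graph. *)
Definition transversal (S : V -> Prop) : Prop :=
  pclosed S /\ ptransversal S /\ forall v, exists g, S (act g v).

Lemma dep_pos v : v <> r -> 0 < dep T v.
Proof. intros H. rewrite (dep_par _ _ T) by auto. lia. Qed.

Lemma rooted_ind (P : V -> Prop) :
  P r -> (forall v, v <> r -> P (par T v) -> P v) -> forall v, P v.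
Proof.
  intros P0 PS. enough (K : forall n v, dep T v = n -> P v) by eauto.
  induction n as [|n IH]; intros v Hv; destruct (classic (v = r)) as [->|Hr]; auto.
  - apply dep_pos in Hr. lia.
  - apply PS; auto. apply IH. rewrite (dep_par _ _ T) in Hv by auto. lia.
Qed.

Section Extend.
Context (D : V -> Prop) (HD : pclosed D) (HT : ptransversal D).

Definition frontier (S : V -> Prop) (v x : V) : Prop :=
  (exists g, x = act g v) /\ exists u, S u /\ adj u x.

(** Each step adds one vertex for every orbit that misses the subtree but has a vertex adjacent to
    it. *)
Fixpoint layer (n : nat) : V -> Prop :=
  match n with
  | 0 => D
  | S n => fun x => layer n x \/
      (~ (exists g, layer n (act g x)) /\ (exists u, layer n u /\ adj u x) /\
       x = epsilon (inhabits r) (frontier (layer n) x))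
  end.

(** Equality of the predicates makes [epsilon] choose the same vertex for a whole orbit. *)
Lemma frontier_orbit S v g : frontier S (act g v) = frontier S v.
Proof.
  apply functional_extensionality. intros x. apply propositional_extensionality.
  unfold frontier. split; intros [[h ->] H]; split; auto.
  - exists (h ** g). now rewrite actM.
  - exists (h ** g^-1). now rewrite actM, actK.
Qed.

Lemma layer_pclosed n : pclosed (layer n).
Proof.
  induction n as [|n IH]; [exact HD|]. split; [left; apply IH|].
  intros v [Hv|(No & (u & Hu & Hadj) & _)] Hr; left; [now apply IH|].
  destruct (adj_par _ _ T _ _ Hadj) as [(_ & ->)|(Hu' & Hp)]; auto.
  (* Here [v] is the parent of [u], so it already lies in [layer n]. *)
  exfalso. apply No. exists gone. rewrite act1 by auto. rewrite <- Hp. now apply IH.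
Qed.

Lemma layer_ptransversal n : ptransversal (layer n).
Proof.
  induction n as [|n IH]; [exact HT|].
  intros g v [Hv|(No & _ & Ev)] [Hgv|(Nog & _ & Egv)]; auto.
  - exfalso. apply Nog. exists (g^-1). now rewrite actK.
  - exfalso. apply No. eauto.
  - rewrite Egv, frontier_orbit. auto.
Qed.

Lemma layer_mono n m v : n <= m -> layer n v -> layer m v.
Proof. induction 1; simpl; auto. Qed.

Lemma ptransversal_extend : exists S, transversal S /\ forall v, D v -> S v.
Proof.
  exists (fun v => exists n, layer n v). split; [|intros v Hv; now exists 0].
  split; [|split].
  - split; [exists 0; apply HD|]. intros v [n Hn] Hr. exists n. now apply layer_pclosed.
  - intros g v [n Hn] [m Hm]. apply (layer_ptransversal (n + m)).
    + now apply (layer_mono n); [lia|].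
    + now apply (layer_mono m); [lia|].
  - apply rooted_ind; [exists gone, 0; rewrite act1; auto; apply HD|].
    intros v Hv (g & n & Hg).
    destruct (classic (exists h, layer n (act h (act g v)))) as [[h Hh]|No].
    + exists (h ** g), n. now rewrite actM.
    (* The orbit of [v] misses the layer but is adjacent to it through the translated parent, so the
       next layer contains its chosen vertex. *)
    + assert (Hf : frontier (layer n) (act g v) (epsilon (inhabits r) (frontier (layer n) (act g v)))).
      { apply epsilon_spec. exists (act g v). split; [exists gone; now rewrite act1|].
        exists (act g (par T v)). split; auto. apply adj_act. now apply (par_adj _ _ T). }
      set (x := epsilon _ _) in *. destruct Hf as [[h Hh] Hx].
      exists (h ** g), (S n). rewrite actM by auto. rewrite <- Hh. right. repeat split; auto.
      * intros [k Hk]. apply No. exists (k ** h). now rewrite actM, <- Hh.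
      * rewrite Hh at 2. rewrite frontier_orbit. reflexivity.
Qed.
End Extend.

(** * Homomorphisms out of a group acting on a tree *)

Section Transversal.
Context (S : V -> Prop) (HS : transversal S).

(** For adjacent vertices: the image of the edge in the quotient lies in the maximal subtree given
    by [S]. *)
Definition tree_pair (u w : V) : Prop := exists g, S (act g u) /\ S (act g w).

Lemma tree_pair_act g u w : tree_pair (act g u) (act g w) <-> tree_pair u w.
Proof.
  split; intros (h & Hu & Hw).
  - exists (h ** g). now rewrite !actM.
  - exists (h ** g^-1). now rewrite !actM, !actK.
Qed.

Lemma tree_pair_sym u w : tree_pair u w -> tree_pair w u.
Proof. intros (g & H1 & H2). exists g; auto. Qed.

Lemma transversal_fix g v : S v -> S (act g v) -> act g v = v.
Proof. apply HS. Qed.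

(** By induction on depth, [U] moves every vertex into [S]. Applied to [g r], this gives [u] in [U]
    such that [u g] fixes [r]. *)
Lemma generated_by_transversal (U : G -> Prop) :
  is_subgroup G U -> (forall s g, S s -> stab s g -> U g) ->
  (forall u w, S u -> adj u w -> ~ tree_pair u w -> exists t, U t /\ S (act t w)) ->
  forall g, U g.
Proof.
  intros HU HUs HUn.
  assert (K : forall v, exists u, U u /\ S (act u v)).
  { apply rooted_ind; [exists gone; rewrite act1 by auto; split; [apply HU|apply HS]|].
    intros v Hv (u & Uu & Su).
    assert (Hadj : adj (act u (par T v)) (act u v)) by (apply adj_act, (par_adj _ _ T); auto).
    destruct (classic (tree_pair (act u (par T v)) (act u v))) as [(h & Sh & Sh')|No].
    (* [h] sends the translated parent from [S] into [S], hence fixes it and lies in [U]. *)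
    - exists (h ** u). rewrite actM by auto. split; auto. apply HU; auto.
      apply (HUs (act u (par T v))); auto. now apply transversal_fix.
    - destruct (HUn _ _ Su Hadj No) as (t & Ut & St).
      exists (t ** u). rewrite actM by auto. split; auto. now apply HU. }
  intros g. destruct (K (act g r)) as (u & Uu & Su).
  rewrite <- actM in Su by auto.
  rewrite <- (gmulK u g). apply HU; [now apply HU|].
  apply (HUs r); [apply HS|]. apply transversal_fix; auto. apply HS.
Qed.

(** * The Bass-Serre homomorphism built from data on a transversal *)

Section BassSerre.
Context {L : group} (phi : V -> G -> L) (gam : V -> V -> L).
Context (phi_hom : forall s, S s -> hom_on (stab s) (phi s)).
Context (phi_agree : forall u w g, S u -> S w -> adj u w -> stab u g -> stab w g -> phi u g = phi w g).
Context (phi_kill : forall u w g, S u -> adj u w -> ~ tree_pair u w -> stab u g -> stab w g -> phi u g = gone).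
Context (gam_act : forall g u w, gam (act g u) (act g w) = gam u w).

(** Carries a chosen representative in [S] to [v]; trivial on [S], so that [cocycle] restricts to
    [phi] there. *)
Definition frame (v : V) : G :=
  if excluded_middle_informative (S v) then gone
  else (epsilon (inhabits gone) (fun g => S (act g v)))^-1.
Definition rep (v : V) : V := act ((frame v)^-1) v.

Lemma rep_in v : S (rep v).
Proof.
  unfold rep, frame. destruct (excluded_middle_informative (S v)).
  - now rewrite ginv1, act1.
  - rewrite ginvK. apply epsilon_spec. apply HS.
Qed.

Lemma frame_rep v : act (frame v) (rep v) = v.
Proof. apply actVK. Qed.

Lemma frame_in v : S v -> frame v = gone.
Proof. unfold frame. now destruct (excluded_middle_informative (S v)). Qed.

Lemma rep_id v : S v -> rep v = v.
Proof. intros H. unfold rep. now rewrite frame_in, ginv1, act1. Qed.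

Lemma rep_act g v : rep (act g v) = rep v.
Proof.
  assert (H : act ((frame (act g v))^-1 ** g ** frame v) (rep v) = rep (act g v)).
  { rewrite !actM, frame_rep by auto. reflexivity. }
  rewrite <- H. apply transversal_fix; [apply rep_in|]. rewrite H. apply rep_in.
Qed.

(** The frames bring [g] back into the stabilizer of [rep v], where [phi] applies; this extends
    [phi] to the action groupoid of [G] on [V]. *)
Definition cocycle (g : G) (v : V) : L := phi (rep v) ((frame (act g v))^-1 ** g ** frame v).

Lemma cocycle_stab g v : stab (rep v) ((frame (act g v))^-1 ** g ** frame v).
Proof. unfold stab. rewrite !actM, frame_rep by auto. apply rep_act. Qed.

Lemma cocycleM g h v : cocycle (g ** h) v = cocycle g (act h v) ** cocycle h v.
Proof.
  unfold cocycle. rewrite rep_act, <- (phi_hom (rep v)).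
  - f_equal. rewrite actM by auto. now gsimp.
  - apply rep_in.
  - rewrite <- (rep_act h v). apply cocycle_stab.
  - apply cocycle_stab.
Qed.

Lemma cocycle_in g s : S s -> stab s g -> cocycle g s = phi s g.
Proof. intros Hs Hg. unfold cocycle. rewrite Hg, rep_id, frame_in by auto. now gsimp. Qed.

(** The defining predicate depends only on the orbit of the pair, so translates share one
    representative. *)
Definition pair_rep (u w : V) : V * V :=
  epsilon (inhabits (r, r)) (fun p => (exists h, act h (fst p) = u /\ act h (snd p) = w) /\
     S (fst p) /\ (tree_pair u w -> S (snd p))).
Definition mover (u w : V) : G :=
  epsilon (inhabits gone) (fun h => act h (fst (pair_rep u w)) = u /\ act h (snd (pair_rep u w)) = w).

Lemma pair_rep_spec u w :
  (act (mover u w) (fst (pair_rep u w)) = u /\ act (mover u w) (snd (pair_rep u w)) = w) /\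
  S (fst (pair_rep u w)) /\ (tree_pair u w -> S (snd (pair_rep u w))).
Proof.
  assert (K : (exists h, act h (fst (pair_rep u w)) = u /\ act h (snd (pair_rep u w)) = w) /\
    S (fst (pair_rep u w)) /\ (tree_pair u w -> S (snd (pair_rep u w)))).
  { unfold pair_rep. apply epsilon_spec.
    destruct (classic (tree_pair u w)) as [(g & Hu & Hw)|No].
    - exists (act g u, act g w). simpl. repeat split; auto. exists (g^-1). now rewrite !actK.
    - destruct (proj2 (proj2 HS) u) as [g Hu].
      exists (act g u, act g w). simpl. repeat split; [|auto|tauto]. exists (g^-1). now rewrite !actK. }
  destruct K as [K1 K2]. split; auto. unfold mover. now apply epsilon_spec.
Qed.

Lemma pair_rep_act g u w : pair_rep (act g u) (act g w) = pair_rep u w.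
Proof.
  unfold pair_rep. f_equal. apply functional_extensionality. intros [a b].
  apply propositional_extensionality. simpl. rewrite tree_pair_act.
  split; intros ([h [H1 H2]] & H); split; auto.
  - exists (g^-1 ** h). now rewrite !actM, H1, H2, !actK.
  - exists (g ** h). now rewrite !actM, H1, H2.
Qed.

Definition gam0 (u w : V) : L :=
  if excluded_middle_informative (tree_pair u w) then gone else gam u w.

Lemma gam0_act g u w : gam0 (act g u) (act g w) = gam0 u w.
Proof.
  unfold gam0. do 2 destruct excluded_middle_informative; auto;
    rewrite tree_pair_act in *; tauto.
Qed.

(** An element fixing both ends has equal values there on a tree edge, and trivial values on any
    other edge. Hence [label] does not depend on the choice of [mover]. *)
Lemma cocycle_gam0 u w k : adj u w -> S u -> (tree_pair u w -> S w) -> stab u k -> stab w k ->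
  cocycle k u ** gam0 u w = gam0 u w ** cocycle k w.
Proof.
  intros Hadj Su Sw Hu Hw. rewrite cocycle_in by auto. unfold gam0.
  destruct excluded_middle_informative as [Ht|Ht].
  - rewrite cocycle_in, gmul1, gmul1r by auto. auto.
  - rewrite (phi_kill u w), gmul1 by auto.
    assert (E : cocycle k w = gone).
    { unfold cocycle. rewrite Hw.
      apply (phi_kill (rep w) (act ((frame w)^-1) u)).
      - apply rep_in.
      - apply adj_act, adj_sym, Hadj.
      - intros H. apply Ht. apply tree_pair_sym. now apply tree_pair_act in H.
      - unfold rep. apply stab_conj. now gsimp.
      - apply stab_conj. now gsimp. }
    now rewrite E, gmul1r.
Qed.

(** Parallel transport along an edge: [gam0] carried from the representative edge, in the way that
    makes it equivariant for [cocycle]. *)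
Definition label (u w : V) : L :=
  cocycle (mover u w) (fst (pair_rep u w)) ** gam0 u w ** (cocycle (mover u w) (snd (pair_rep u w)))^-1.

Lemma label_rep u w h : adj u w ->
  act h (fst (pair_rep u w)) = u -> act h (snd (pair_rep u w)) = w ->
  label u w = cocycle h (fst (pair_rep u w)) ** gam0 u w ** (cocycle h (snd (pair_rep u w)))^-1.
Proof.
  intros Hadj Hu Hw. destruct (pair_rep_spec u w) as ((Mu & Mw) & Su & Sw).
  unfold label. set (u0 := fst (pair_rep u w)) in *. set (w0 := snd (pair_rep u w)) in *.
  set (m := mover u w) in *.
  assert (Hk : stab u0 (m^-1 ** h)) by (apply act_eq_stab; congruence).
  assert (Hk' : stab w0 (m^-1 ** h)) by (apply act_eq_stab; congruence).
  assert (Eh : h = m ** (m^-1 ** h)) by now gsimp.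
  assert (Hadj0 : adj u0 w0).
  { apply (adj_act (m^-1)) in Hadj. now rewrite <- Mu, <- Mw, !actK in Hadj. }
  assert (E0 : gam0 u0 w0 = gam0 u w) by now rewrite <- (gam0_act m), Mu, Mw.
  assert (Et : tree_pair u0 w0 -> S w0).
  { intros Ht. apply Sw. rewrite <- Mu, <- Mw. now apply tree_pair_act. }
  assert (C := cocycle_gam0 u0 w0 (m^-1 ** h) Hadj0 Su Et Hk Hk').
  rewrite E0 in C. rewrite Eh, (cocycleM m _ u0), (cocycleM m _ w0), Hk, Hk'.
  apply (f_equal (fun z => cocycle m u0 ** z)) in C. rewrite !gmulA in C. rewrite C. now gsimp.
Qed.

Lemma label_act g u w : adj u w ->
  label (act g u) (act g w) = cocycle g u ** label u w ** (cocycle g w)^-1.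
Proof.
  intros Hadj. destruct (pair_rep_spec u w) as ((Mu & Mw) & _).
  rewrite (label_rep (act g u) (act g w) (g ** mover u w)).
  - rewrite pair_rep_act, gam0_act, !cocycleM, Mu, Mw. unfold label. now gsimp.
  - now apply adj_act.
  - now rewrite pair_rep_act, actM, Mu.
  - now rewrite pair_rep_act, actM, Mw.
Qed.

(** The mover sends both representatives from [S] into [S], so it fixes them, and [phi] agrees on
    their edge. *)
Lemma label_in u w : adj u w -> S u -> S w -> label u w = gone.
Proof.
  intros Hadj Su Sw. destruct (pair_rep_spec u w) as ((Mu & Mw) & Su0 & Sw0).
  assert (Ht : tree_pair u w) by (exists gone; now rewrite !act1).
  specialize (Sw0 Ht). unfold label, gam0. destruct excluded_middle_informative; [|tauto].
  set (u0 := fst _) in *. set (w0 := snd _) in *. set (m := mover u w) in *.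
  assert (Hu : stab u0 m) by (apply transversal_fix; congruence).
  assert (Hw : stab w0 m) by (apply transversal_fix; congruence).
  rewrite !cocycle_in by auto. rewrite (phi_agree u0 w0); auto; [now gsimp|].
  rewrite Hu, Hw in *. congruence.
Qed.

(** [label] need not be inverted when its arguments are exchanged, so the orientation of the arc
    decides which value is taken. *)
Definition climb (v : V) : L :=
  if excluded_middle_informative (arc (par T v) v) then label (par T v) v else (label v (par T v))^-1.

Fixpoint potential_at (n : nat) (v : V) : L :=
  match n with
  | 0 => gone
  | Datatypes.S n => potential_at n (par T v) ** climb v
  end.
Definition potential (v : V) : L := potential_at (dep T v) v.

Lemma potential_root : potential r = gone.
Proof. unfold potential. now rewrite (dep_root _ _ T). Qed.

Lemma potential_par v : v <> r -> potential v = potential (par T v) ** climb v.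
Proof. intros Hv. unfold potential. now rewrite (dep_par _ _ T) by auto. Qed.

Lemma potential_arc u w : arc u w -> potential w = potential u ** label u w.
Proof.
  intros H. destruct (adj_par _ _ T u w) as [[Hr Hp]|[Hr Hp]]; [now left| |];
    rewrite (potential_par _ Hr); unfold climb; rewrite Hp;
    destruct excluded_middle_informative; try tauto.
  - exfalso. now apply (arc_anti HA u w).
  - now gsimp.
Qed.

Lemma potential_in s : S s -> potential s = gone.
Proof.
  revert s. apply (rooted_ind (fun s => S s -> potential s = gone)); [intros _; apply potential_root|].
  intros v Hv IH Sv. assert (Sp : S (par T v)) by now apply HS.
  rewrite potential_par, IH, gmul1 by auto.
  assert (adj (par T v) v) by now apply (par_adj _ _ T).
  unfold climb. destruct excluded_middle_informative; rewrite label_in; auto; [|now apply adj_sym].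
  apply ginv1.
Qed.

(* [dev g v] does not depend on [v]; since [cocycle] is a cocycle, this makes [dev] multiplicative
   in [g]. *)
Definition dev (g : G) (v : V) : L := potential (act g v) ** cocycle g v ** (potential v)^-1.

Lemma dev_arc g u w : arc u w -> dev g u = dev g w.
Proof.
  intros H. unfold dev. rewrite (potential_arc u w) by auto.
  rewrite (potential_arc (act g u) (act g w)) by now apply arc_act.
  rewrite label_act by now left. now gsimp.
Qed.

Lemma dev_root g v : dev g v = dev g r.
Proof.
  revert v. apply rooted_ind; auto. intros v Hv <-.
  destruct (par_adj _ _ T v Hv) as [H|H]; [symmetry|]; now apply dev_arc.
Qed.

(** The potential is trivial on [S], so the stabilizers there are mapped by [phi]; the last clause
    gives the stable letters the values [gam]. *)
Lemma bass_serre_hom : exists f : G -> L,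
  (forall g h, f (g ** h) = f g ** f h) /\
  (forall s g, S s -> stab s g -> f g = phi s g) /\
  (forall u w, arc u w -> ~ tree_pair u w -> exists g, f g = gam u w).
Proof.
  exists (fun g => dev g r). split; [|split].
  - intros g h. rewrite <- (dev_root g (act h r)). unfold dev.
    rewrite actM, cocycleM by auto. now gsimp.
  - intros s g Hs Hg. rewrite <- (dev_root g s). unfold dev.
    rewrite Hg, potential_in, cocycle_in by auto. now gsimp.
  - intros u w Ha Ht. destruct (pair_rep_spec u w) as ((Mu & Mw) & Su0 & _).
    set (u0 := fst _) in *. set (w0 := snd _) in *. set (m := mover u w) in *.
    assert (Ha0 : arc u0 w0) by (rewrite <- (actK m u0), <- (actK m w0), Mu, Mw; now apply arc_act).
    (* The stable letter: it carries [rep w0] in [S] to the far end [w0] of an edge leaving [S], so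
       [dev] at [rep w0] is the label of that edge. *)
    exists (frame w0). rewrite <- (dev_root _ (rep w0)). unfold dev.
    rewrite frame_rep, (potential_in (rep w0)) by apply rep_in.
    rewrite (potential_arc u0 w0), (potential_in u0) by auto.
    assert (E : pair_rep u0 w0 = (u0, w0)).
    { rewrite <- (pair_rep_act m), Mu, Mw. apply surjective_pairing. }
    rewrite (label_rep u0 w0 gone); [|now left|now rewrite E, act1|now rewrite E, act1].
    rewrite E. cbn [fst snd].
    assert (C1 : forall v, cocycle gone v = gone).
    { intros v. apply (gcancel (cocycle gone v)). rewrite gmul1r.
      rewrite <- (act1 HA v) at 1. rewrite <- cocycleM. now rewrite gmul1. }
    rewrite !C1.
    assert (C2 : cocycle (frame w0) (rep w0) = gone).
    { rewrite <- (C1 (rep w0)). unfold cocycle. rewrite frame_rep, act1 by auto.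
      rewrite (frame_in (rep w0)) by apply rep_in. now gsimp. }
    rewrite C2, <- (gam0_act m), Mu, Mw. unfold gam0.
    destruct excluded_middle_informative; [tauto|]. now gsimp.
Qed.
End BassSerre.

(** * Extending data from a subtree of the transversal by retractions *)

Section Propagate.
Context {L : group} (D : V -> Prop) (HD : pclosed D) (DS : forall v, D v -> S v).
Context (phi : V -> G -> L) (gam : V -> V -> L).
Context (stab_comm : forall v, commuting (stab v) (stab v)).
Context (edge_factor : forall u w, adj u w -> direct_factor G (fun g => stab u g /\ stab w g) (stab w)).
Context (phi_hom : forall s, D s -> hom_on (stab s) (phi s)).
Context (phi_agree : forall w g, D w -> w <> r -> stab (par T w) g -> stab w g -> phi (par T w) g = phi w g).
Context (phi_kill : forall u w g, S u -> adj u w -> ~ tree_pair u w ->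
  D u /\ (stab u g -> stab w g -> phi u g = gone)).
Context (gam_act : forall g u w, gam (act g u) (act g w) = gam u w).

Definition retract (v : V) : G -> G :=
  epsilon (inhabits (fun g => g)) (fun f => hom_on (stab v) f /\
    (forall x, stab v x -> stab (par T v) (f x) /\ stab v (f x)) /\
    (forall x, stab (par T v) x /\ stab v x -> f x = x)).

Lemma retract_spec v : v <> r -> hom_on (stab v) (retract v) /\
    (forall x, stab v x -> stab (par T v) (retract v x) /\ stab v (retract v x)) /\
    (forall x, stab (par T v) x /\ stab v x -> retract v x = x).
Proof.
  intros Hv. unfold retract. apply epsilon_spec.
  apply (direct_factor_retract (fun x => stab (par T v) x /\ stab v x)); auto.
  now apply edge_factor, (par_adj _ _ T).
Qed.

(** Outside [D] the map is that of the parent, composed with the retraction onto the edge group.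
    Depth 0 is the root, which lies in [D]. *)
Fixpoint spread_at (n : nat) (v : V) : G -> L :=
  match n with
  | 0 => phi v
  | Datatypes.S n => if excluded_middle_informative (D v) then phi v
      else fun g => spread_at n (par T v) (retract v g)
  end.
Definition spread (v : V) : G -> L := spread_at (dep T v) v.

Lemma spread_in v : D v -> spread v = phi v.
Proof. intros H. unfold spread. destruct (dep T v); simpl; auto. now destruct excluded_middle_informative. Qed.

Lemma spread_out v g : ~ D v -> spread v g = spread (par T v) (retract v g).
Proof.
  intros H. assert (Hv : v <> r) by (intros ->; apply H, HD).
  unfold spread. rewrite (dep_par _ _ T) by auto. simpl. now destruct excluded_middle_informative.
Qed.

Lemma spread_hom v : hom_on (stab v) (spread v).
Proof.
  revert v. apply rooted_ind.
  - rewrite spread_in by apply HD. apply phi_hom, HD.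
  - intros v Hv IH x y Hx Hy. destruct (classic (D v)) as [Dv|Nv].
    + rewrite spread_in by auto. now apply phi_hom.
    + destruct (retract_spec v Hv) as (R1 & R2 & _).
      rewrite !(spread_out v) by auto. rewrite R1 by auto. apply IH; now apply R2.
Qed.

Lemma spread_par v g : v <> r -> stab (par T v) g -> stab v g -> spread (par T v) g = spread v g.
Proof.
  intros Hv Hg Hg'. destruct (classic (D v)) as [Dv|Nv].
  - rewrite !spread_in by (auto; now apply HD). now apply phi_agree.
  - rewrite (spread_out v) by auto. destruct (retract_spec v Hv) as (_ & _ & R3). now rewrite R3.
Qed.

Lemma bass_serre_hom_propagated : exists f : G -> L,
  (forall g h, f (g ** h) = f g ** f h) /\
  (forall s g, D s -> stab s g -> f g = phi s g) /\
  (forall u w, arc u w -> ~ tree_pair u w -> exists g, f g = gam u w).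
Proof.
  destruct (bass_serre_hom spread gam) as (f & Hf & Hs & Hg); auto.
  - intros; apply spread_hom.
  - intros u w g _ _ Hadj Hu Hw. destruct (adj_par _ _ T u w Hadj) as [[Hr <-]|[Hr <-]].
    + now apply spread_par.
    + symmetry. now apply spread_par.
  (* Non-tree edges start in [D], where [spread] is [phi]. *)
  - intros u w g Su Hadj Ht Hu Hw. destruct (phi_kill u w g Su Hadj Ht) as [Du K].
    rewrite spread_in; auto.
  - exists f. repeat split; auto. intros s g Ds Hg'. rewrite <- spread_in; auto.
Qed.
End Propagate.
End Transversal.
End Root.
End Action.

(** [N] generates the group spanned by all values of the family. After division the values span Z,
    so an image containing all powers [a^(lam' i x)] contains [a]. *)
Lemma zhom_primitive {G : group} {I : Type} (B : I -> G -> Prop) (lam : I -> G -> Z) i0 x0 :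
  (forall i, is_subgroup G (B i)) -> (forall i, zhom_on (B i) (lam i)) -> B i0 x0 -> lam i0 x0 <> 0%Z ->
  exists lam' N, (0 < N)%Z /\ (forall i x, B i x -> lam i x = N * lam' i x)%Z /\
   (forall i, zhom_on (B i) (lam' i)) /\
   forall (L : group) (a : L) (f : G -> L), (forall x y, f (x ** y) = f x ** f y) ->
     (forall i x, B i x -> exists g, f g = gzpow L a (lam' i x)) -> exists g, f g = a.
Proof.
  intros HB Hlam Hx0 Hne.
  destruct (zvalues_normalise (fun z => exists i x, B i x /\ lam i x = z) (lam i0 x0)) as (N & HN & Div & Gen); eauto.
  assert (E : forall i x, B i x -> lam i x = (N * (lam i x / N))%Z).
  { intros i x Hx. destruct (Div (lam i x)) as [w Hw]; eauto. rewrite Hw at 2.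
    rewrite (Z.mul_comm N w), Z.div_mul by lia. lia. }
  exists (fun i x => (lam i x / N)%Z), N. repeat split; auto.
  - intros i x y Hx Hy. apply (Z.mul_reg_l _ _ N); [lia|].
    rewrite Z.mul_add_distr_l, <- !E by (auto; now apply HB). now apply Hlam.
  - intros L a f Hf Him.
    assert (T : is_subgroup G (fun _ => True)) by (repeat split).
    assert (Hf' : hom_on (fun _ => True) f) by (intros ? ? _ _; apply Hf).
    rewrite <- (gzpow_1 a). apply (Gen (fun z => exists g, f g = gzpow L a z)).
    + exists gone. now apply (hom_on_1 (fun _ => True)).
    + intros u v [g Hg] [h Hh]. exists (g ** h). now rewrite Hf, gzpow_add, Hg, Hh.
    + intros u [g Hg]. exists (g^-1). now rewrite (hom_on_inv (fun _ => True)), gzpow_opp, Hg.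
    + intros w (i & x & Hx & Ex). destruct (Him i x Hx) as [g Hg]. exists g.
      rewrite Ex, (Z.mul_comm N w), Z.div_mul in Hg by lia. exact Hg.
Qed.

Lemma gzpow_hom_on {G L : group} (B : G -> Prop) (a : L) (lam : G -> Z) :
  zhom_on B lam -> hom_on B (fun g => gzpow L a (lam g)).
Proof. intros H x y Hx Hy. now rewrite H, gzpow_add. Qed.

(** * Two independent cycles, change of root, and paths embedded in the quotient *)

Section QuotientPaths.
Context {G : group} {V : Type} (act : G -> V -> V) (arc : V -> V -> Prop).
Notation adj := (adjacent arc).
Notation stab := (stab act).
Notation tree_pair := (tree_pair act).
Context (HA : arc_action act arc).
Context (rt : forall r, rooted adj r).

(** All stabilizers are killed, and the stable letters of the two edge orbits go to the two
    generators. *)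
Lemma maps_onto_F2_of_two_loops r (T : rooted adj r) S u1 w1 u2 w2 :
  transversal act arc T S -> arc u1 w1 -> ~ tree_pair S u1 w1 -> arc u2 w2 -> ~ tree_pair S u2 w2 ->
  ~ (exists g, u2 = act g u1 /\ w2 = act g w1) -> maps_onto_F2 G.
Proof.
  intros HS A1 N1 A2 N2 No.
  pose (same := fun u w => exists g, u = act g u1 /\ w = act g w1).
  destruct (bass_serre_hom act arc HA T S HS (fun _ _ => gone)
    (fun u w => F2letter (if excluded_middle_informative (same u w) then true else false)))
    as (f & Hf & _ & Hg).
  - intros s _ x y _ _. now rewrite gmul1.
  - auto.
  - auto.
  - intros g u w. do 2 destruct excluded_middle_informative as [?|?]; auto; exfalso.
    + destruct s as (h & Hu & Hw). apply n. exists (g^-1 ** h).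
      now rewrite !(actM _ _ HA), <- Hu, <- Hw, !(actK _ _ HA).
    + destruct s as (h & Hu & Hw). apply n. exists (g ** h).
      now rewrite !(actM _ _ HA), <- Hu, <- Hw.
  - apply (maps_onto_F2_of_hom G f Hf). intros [].
    + destruct (Hg u1 w1 A1 N1) as [g Eg]. exists g. rewrite Eg.
      destruct excluded_middle_informative as [_|No1]; auto.
      exfalso. apply No1. exists gone. now rewrite !(act1 _ _ HA).
    + destruct (Hg u2 w2 A2 N2) as [g Eg]. exists g. rewrite Eg.
      destruct excluded_middle_informative as [Y|_]; auto. now destruct (No Y).
Qed.

(** If the path from [v] to [r'] left [S], its edge out of [S] would point away from [r], and so
    would every later edge; the path would never come back to [r'] in [S]. *)
Lemma pclosed_reroot r r' (T : rooted adj r) (T' : rooted adj r') S :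
  pclosed arc T S -> S r' -> pclosed arc T' S.
Proof.
  intros [HSr HS] Hr'. split; auto.
  assert (K : forall y, ~ S y -> y <> r -> forall v, v <> r' -> par T y = v -> par T' v = y -> False).
  { apply (rooted_ind arc T' (fun y => ~ S y -> y <> r -> forall v, v <> r' -> par T y = v -> par T' v = y -> False)).
    - intros Ny. tauto.
    - intros y Hy IH Ny Hyr v Hv E1 E2.
      assert (Ha := par_adj _ _ T' y Hy).
      destruct (adj_par _ _ T _ _ Ha) as [[_ E]|[Hz E]].
      + assert (D1 := dep_par _ _ T' y Hy). assert (D2 := dep_par _ _ T' v Hv).
        rewrite E2 in D2. rewrite <- E, E1 in D1. lia.
      + apply (IH) with (v := y); auto.
        intros Sz. apply Ny. rewrite <- E. auto. }
  intros v Sv Hv. apply NNPP. intros Ny.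
  assert (Ha := par_adj _ _ T' v Hv).
  destruct (adj_par _ _ T _ _ Ha) as [[Hvr E]|[Hz E]].
  - apply Ny. rewrite <- E. auto.
  - apply (K (par T' v)) with (v := v); auto.
Qed.

Lemma transversal_reroot r r' (T : rooted adj r) (T' : rooted adj r') S :
  transversal act arc T S -> S r' -> transversal act arc T' S.
Proof. intros (H1 & H2 & H3) Hr'. split; [now apply (pclosed_reroot r r' T)|auto]. Qed.

Lemma transversal_exists r : exists S, transversal act arc (rt r) S.
Proof.
  destruct (ptransversal_extend act arc HA (rt r) (fun v => v = r)) as (S & HS & _); eauto.
  - split; [auto|tauto].
  - intros g v -> E. exact E.
Qed.

(** The path is indexed from the root: [k = 0] gives [r] and [k = dep T v] gives [v]. *)
Definition ancestor {r} (T : rooted adj r) (v : V) (k : nat) : V := Nat.iter (dep T v - k) (par T) v.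

Lemma ancestor_iter {r} (T : rooted adj r) v j :
  j <= dep T v -> dep T (Nat.iter j (par T) v) = dep T v - j.
Proof.
  induction j as [|j IH]; intros Hj; simpl; [lia|].
  assert (IHj := IH ltac:(lia)).
  assert (Hr : Nat.iter j (par T) v <> r).
  { intros E. rewrite E, (dep_root _ _ T) in IHj. lia. }
  rewrite (dep_par _ _ T _ Hr) in IHj. lia.
Qed.

Lemma dep_0 {r} (T : rooted adj r) v : dep T v = 0 -> v = r.
Proof. intros H. apply NNPP. intros Hv. apply (dep_pos arc T) in Hv. lia. Qed.

Lemma ancestor_dep {r} (T : rooted adj r) v k : k <= dep T v -> dep T (ancestor T v k) = k.
Proof. intros H. unfold ancestor. rewrite ancestor_iter; lia. Qed.

Lemma ancestor_0 {r} (T : rooted adj r) v : ancestor T v 0 = r.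
Proof. apply (dep_0 T). apply ancestor_dep. lia. Qed.

Lemma ancestor_self {r} (T : rooted adj r) v : ancestor T v (dep T v) = v.
Proof. unfold ancestor. now rewrite Nat.sub_diag. Qed.

Lemma ancestor_adj {r} (T : rooted adj r) v k :
  k < dep T v -> adj (ancestor T v k) (ancestor T v (S k)).
Proof.
  intros H. assert (E : ancestor T v k = par T (ancestor T v (S k))).
  { unfold ancestor. now replace (dep T v - k) with (S (dep T v - S k)) by lia. }
  rewrite E. apply (par_adj _ _ T). intros E'.
  assert (D := ancestor_dep T v (S k) H). rewrite E', (dep_root _ _ T) in D. lia.
Qed.

Lemma ancestor_in {r} (T : rooted adj r) S v k : pclosed arc T S -> S v -> S (ancestor T v k).
Proof.
  intros [Sr HS] Sv. unfold ancestor.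
  assert (K : forall j, j <= dep T v -> S (Nat.iter j (par T) v)); [|apply K; lia].
  induction j as [|j IH]; intros Hj; simpl; auto. apply HS; [apply IH; lia|].
  intros E. assert (D := ancestor_iter T v j ltac:(lia)). rewrite E, (dep_root _ _ T) in D. lia.
Qed.

(** A path without backtracking moves away from the root at every step: a step towards it would
    return to the previous vertex. *)
Lemma path_dep {r} (T : rooted adj r) (x : nat -> V) n :
  x 0 = r -> (forall k, k < n -> adj (x k) (x (S k))) -> (forall k, S (S k) <= n -> x (S (S k)) <> x k) ->
  forall k, k <= n -> dep T (x k) = k /\ forall j, k = S j -> x k <> r /\ par T (x k) = x j.
Proof.
  intros X0 Xadj Xred. induction k as [|k IH]; intros Hk.
  - rewrite X0, (dep_root _ _ T). split; [auto|discriminate].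
  - destruct IH as [Dk Pk]; [lia|].
    destruct (adj_par _ _ T _ _ (Xadj k Hk)) as [[Hr Hp]|[Hr Hp]].
    + rewrite (dep_par _ _ T _ Hr), Hp, Dk. split; [reflexivity|]. intros j E. now injection E as <-.
    + destruct k as [|k]; [tauto|]. exfalso. apply (Xred k); auto.
      destruct (Pk k eq_refl) as [_ E]. congruence.
Qed.

(* The path embeds in the quotient graph. *)
Definition tpath (x : nat -> V) (n : nat) : Prop :=
  (forall k, k < n -> adj (x k) (x (S k))) /\
  forall i j g, i <= n -> j <= n -> x j = act g (x i) -> i = j.

Lemma tpath_inj x n i j : tpath x n -> i <= n -> j <= n -> x i = x j -> i = j.
Proof. intros [_ H] Hi Hj E. apply (H i j gone); auto. now rewrite (act1 _ _ HA). Qed.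

Lemma tpath_dep {r} (T : rooted adj r) x n : tpath x n -> x 0 = r ->
  forall k, k <= n -> dep T (x k) = k /\ forall j, k = S j -> x k <> r /\ par T (x k) = x j.
Proof.
  intros Hx X0. apply path_dep; [auto|apply Hx|].
  intros k Hk E. apply (tpath_inj x n) in E; auto; lia.
Qed.

Lemma tpath_pclosed {r} (T : rooted adj r) x n : tpath x n -> x 0 = r ->
  pclosed arc T (fun v => exists k, k <= n /\ v = x k).
Proof.
  intros Hx X0. split; [exists 0; split; [lia|auto]|].
  intros v (k & Hk & ->) Hr. destruct (tpath_dep T x n Hx X0 k Hk) as [_ K].
  destruct k as [|k]; [now destruct Hr|]. exists k. split; [lia|]. now apply K.
Qed.

Lemma tpath_extend {r} (T : rooted adj r) x n : tpath x n -> x 0 = r ->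
  exists S, transversal act arc T S /\ forall k, k <= n -> S (x k).
Proof.
  intros Hx X0. destruct (ptransversal_extend act arc HA T (fun v => exists k, k <= n /\ v = x k))
    as (S & HS & DS).
  - now apply tpath_pclosed.
  - intros g v (i & Hi & ->) (j & Hj & E). rewrite E.
    assert (i = j) as -> by (apply (proj2 Hx i j g); auto). reflexivity.
  - exists S. split; eauto.
Qed.

Lemma ancestor_tpath {r} (T : rooted adj r) S v : transversal act arc T S -> S v ->
  tpath (ancestor T v) (dep T v).
Proof.
  intros HS Sv. split; [intros; now apply ancestor_adj|].
  intros i j g Hi Hj E.
  assert (Si : S (ancestor T v i)) by (apply ancestor_in; auto; apply HS).
  assert (Sj : S (ancestor T v j)) by (apply ancestor_in; auto; apply HS).
  rewrite E in Sj. apply (transversal_fix act arc T S HS) in Sj; auto.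
  rewrite <- (ancestor_dep T v i), <- (ancestor_dep T v j) by auto. congruence.
Qed.

(** Otherwise [stab p] commutes with the stabilizers of a transversal through [p]. These generate
    [G], as there are no stable letters, so every stabilizer is central and [G] is abelian. *)
Lemma noncommuting_tpath (r : V) :
  (forall r S u w, transversal act arc (rt r) S -> adj u w -> tree_pair S u w) ->
  ~ (forall x y : G, x ** y = y ** x) ->
  exists x n, tpath x n /\ ~ commuting (stab (x 0)) (stab (x n)).
Proof.
  intros Htree Hab. apply NNPP. intros No. apply Hab. clear Hab.
  assert (gen : forall p (U : G -> Prop), is_subgroup G U ->
    (forall S s g, transversal act arc (rt p) S -> S s -> stab s g -> U g) -> forall g, U g).
  { clear r. intros r U HU HUs. destruct (transversal_exists r) as [S HS].
    apply (generated_by_transversal act arc HA (rt r) S HS); eauto.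
    intros u w Su Ha Ht. destruct Ht. eauto. }
  assert (central : forall p g, stab p g -> forall h, h ** g = g ** h).
  { clear r. intros r. assert (K : forall h g, stab r g -> h ** g = g ** h); [|auto].
    apply (gen r (fun h => forall g, stab r g -> h ** g = g ** h)); [apply centralizer_subgroup|].
    intros S s h HS Ss Hh g Hg.
    assert (C : commuting (stab r) (stab s)).
    { apply NNPP. intros NC. apply No. exists (ancestor (rt r) s), (dep (rt r) s).
      rewrite ancestor_0, ancestor_self. split; auto. now apply (ancestor_tpath (rt r) S). }
    symmetry. now apply C. }
  intros x y. revert x y. apply (gen r (fun x => forall y, x ** y = y ** x)).
  - repeat split.
    + intros y. now gsimp.
    + intros x z Hx Hz y. now rewrite <- gmulA, Hz, gmulA, Hx, <- gmulA.
    + intros x Hx y. now apply commute_inv.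
  - intros S s g _ _ Hg y. symmetry. now apply (central s).
Qed.
End QuotientPaths.

(** * Quotient graphs with at most one cycle *)

Section QuotientTree.
Context {G : group} {V : Type} (act : G -> V -> V) (arc : V -> V -> Prop).
Notation adj := (adjacent arc).
Notation stab := (stab act).
Notation tree_pair := (tree_pair act).
Context (HA : arc_action act arc).
Context (rt : forall r, rooted adj r).
Context (stab_fgtf : forall v, fgtf_abelian (stab v)).
Context (edge_factor : forall u w, adj u w -> direct_factor G (fun g => stab u g /\ stab w g) (stab w)).

Lemma stab_comm v : commuting (stab v) (stab v).
Proof. apply stab_fgtf. Qed.

(** Separate [x] from the edge group, then divide by the generator of the values so that the image
    contains [a] itself. *)
Lemma zhom_kill_edge u w x : adj u w -> stab w x -> ~ stab u x ->
  exists lam, zhom_on (stab w) lam /\ (forall g, stab u g -> stab w g -> lam g = 0%Z) /\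
   forall (L : group) (a : L) (f : G -> L), (forall x y, f (x ** y) = f x ** f y) ->
     (forall x, stab w x -> f x = gzpow L a (lam x)) -> exists g, f g = a.
Proof.
  intros Ha Hx Nx.
  destruct (zhom_separate (fun g => stab u g /\ stab w g) (stab w) x) as (lam & Hlam & K & Hne); auto; [tauto|].
  destruct (zhom_primitive (fun _ : unit => stab w) (fun _ => lam) tt x) as (lam' & N & HN & E & Hlam' & Im); auto.
  { intros _. apply stab_fgtf. }
  exists (lam' tt). split; [apply Hlam'|split].
  - intros g Hu Hw. assert (E' := E tt g Hw). rewrite K in E' by auto. nia.
  - intros L a f Hf Hfl. apply (Im L a f Hf). intros [] y Hy. exists y. auto.
Qed.

Lemma maps_onto_F2_quotient_tree (r : V) :
  (forall r S u w, transversal act arc (rt r) S -> adj u w -> tree_pair S u w) ->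
  ~ (forall x y : G, x ** y = y ** x) -> maps_onto_F2 G.
Proof.
  intros Htree Hab. destruct (noncommuting_tpath act arc HA rt r Htree Hab) as (x1 & n1 & H1 & H1').
  destruct (dec_inh_nat_subset_has_unique_least_element
    (fun n => exists x, tpath act arc x n /\ ~ commuting (stab (x 0)) (stab (x n)))) as (n & ((x & Hx & NC) & Min) & _).
  { intros; apply classic. }
  { eauto. }
  clear x1 n1 H1 H1'.
  assert (Hn : exists m, n = S m).
  { destruct n as [|m]; eauto. destruct NC. apply stab_comm. }
  destruct Hn as [m ->].
  assert (adj0 : adj (x 1) (x 0)) by (apply adj_sym, Hx; lia).
  assert (adjm : adj (x m) (x (S m))) by (apply Hx; lia).
  (* Otherwise dropping [x 0] would leave a shorter path whose end stabilizers do not commute. The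
     other end is symmetric. *)
  assert (N0 : exists g, stab (x 0) g /\ ~ stab (x 1) g).
  { apply NNPP. intros No. apply NC. intros g h Hg Hh.
    assert (C : commuting (stab (x 1)) (stab (x (S m)))).
    { apply NNPP. intros NC'. assert (S m <= m); [|lia]. apply Min.
      exists (fun k => x (S k)). split; auto. split.
      - intros k Hk. apply Hx. lia.
      - intros i j k Hi Hj E. apply (proj2 Hx) in E; lia. }
    apply C; auto. apply NNPP. intros Ng. apply No. eauto. }
  assert (Nm : exists g, stab (x (S m)) g /\ ~ stab (x m) g).
  { apply NNPP. intros No. apply NC. intros g h Hg Hh.
    assert (C : commuting (stab (x 0)) (stab (x m))).
    { apply NNPP. intros NC'. assert (S m <= m); [|lia]. apply Min.
      exists x. split; auto. split.
      - intros k Hk. apply Hx. lia.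
      - intros i j k Hi Hj E. apply (proj2 Hx) in E; lia. }
    apply C; auto. apply NNPP. intros Nh. apply No. eauto. }
  destruct N0 as (g0 & Hg0 & Ng0), Nm as (gm & Hgm & Ngm).
  destruct (zhom_kill_edge _ _ g0 adj0 Hg0 Ng0) as (lam & Hlam & Klam & Ilam).
  destruct (zhom_kill_edge _ _ gm adjm Hgm Ngm) as (mu & Hmu & Kmu & Imu).
  destruct (tpath_extend act arc HA (rt (x 0)) x (S m) Hx eq_refl) as (T & HT & xT).
  (* Supported at the two ends of the path. Each functional kills its edge group, so all values on
     edges of the path are trivial. *)
  pose (phi := fun v g => if excluded_middle_informative (v = x 0) then gzpow F2 (F2letter true) (lam g)
     else if excluded_middle_informative (v = x (S m)) then gzpow F2 (F2letter false) (mu g) else gone).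
  assert (inj : forall i j, i <= S m -> j <= S m -> x i = x j -> i = j).
  { intros i j. apply (tpath_inj act arc HA x (S m)); auto. }
  assert (phi0 : forall g, phi (x 0) g = gzpow F2 (F2letter true) (lam g)).
  { intros g. unfold phi. now destruct excluded_middle_informative. }
  assert (phim : forall g, phi (x (S m)) g = gzpow F2 (F2letter false) (mu g)).
  { intros g. unfold phi. destruct excluded_middle_informative as [E|E].
    - apply inj in E; lia.
    - now destruct excluded_middle_informative. }
  assert (phio : forall i g, i <> 0 -> i < S m -> phi (x i) g = gone).
  { intros i g Hi Hi'. unfold phi. destruct excluded_middle_informative as [E|E].
    - apply inj in E; lia.
    - destruct excluded_middle_informative as [E'|E']; auto. apply inj in E'; lia. }
  assert (kill0 : forall g, stab (x 1) g -> stab (x 0) g -> phi (x 0) g = gone).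
  { intros g H1 H0. now rewrite phi0, Klam. }
  assert (killm : forall g, stab (x m) g -> stab (x (S m)) g -> phi (x (S m)) g = gone).
  { intros g H1 H0. now rewrite phim, Kmu. }
  destruct (bass_serre_hom_propagated act arc HA (rt (x 0)) T HT (L := F2) (fun v => exists k, k <= S m /\ v = x k))
    with (phi := phi) (gam := fun _ _ : V => @gone F2) as (f & Hf & Hphi & _); auto.
  - now apply (tpath_pclosed act arc HA).
  - intros v (k & Hk & ->). auto.
  - apply stab_comm.
  - intros v (k & Hk & ->). destruct (Nat.eq_dec k 0) as [->|H0]; [|destruct (Nat.eq_dec k (S m)) as [->|Hm]].
    + intros g h Hg Hh. rewrite !phi0. now apply (gzpow_hom_on (stab (x 0))).
    + intros g h Hg Hh. rewrite !phim. now apply (gzpow_hom_on (stab (x (S m)))).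
    + intros g h Hg Hh. rewrite !phio by lia. now rewrite gmul1.
  - intros w g (k & Hk & ->) Hr. destruct (tpath_dep act arc HA (rt (x 0)) x (S m) Hx eq_refl k Hk) as [_ P].
    destruct k as [|k]; [now destruct Hr|]. destruct (P k eq_refl) as [_ ->]. intros Hg Hg'.
    assert (L : phi (x k) g = gone).
    { destruct k; [now apply kill0|apply phio; lia]. }
    rewrite L. symmetry. destruct (Nat.eq_dec k m) as [->|]; [now apply killm|apply phio; lia].
  - intros u w g _ Ha Ht. destruct Ht. eapply Htree; eauto.
  - apply (maps_onto_F2_of_hom G f Hf). intros [].
    + apply Ilam; auto. intros g Hg. rewrite <- phi0. apply Hphi; auto. exists 0. split; [lia|auto].
    + apply Imu; auto. intros g Hg. rewrite <- phim. apply Hphi; auto. exists (S m). auto.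
Qed.

End QuotientTree.

(** * Cycles of the quotient graph and their lifts to lines *)

Section QuotientLoops.
Context {G : group} {V : Type} (act : G -> V -> V) (arc : V -> V -> Prop).
Notation adj := (adjacent arc).
Notation stab := (stab act).
Notation tree_pair := (tree_pair act).
Notation tpath := (tpath act arc).
Context (HA : arc_action act arc).
Context (rt : forall r, rooted adj r).

(* A lift to the tree of an embedded cycle with [m + 1] edges of the quotient graph. *)
Record loop (t : G) (m : nat) (y : nat -> V) : Prop := Loop {
  loop_shift : forall k, y (k + S m) = act t (y k);
  loop_adj : forall k, adj (y k) (y (S k));
  loop_orbit : forall i j g, y j = act g (y i) -> exists c, i = j + c * S m \/ j = i + c * S m;
  loop_fold : forall k g, m = 1 -> act g (y (S k)) = y (S k) -> act g (y (S (S k))) <> y k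
}.

Lemma loop_from t m y k : loop t m y -> loop t m (fun i => y (k + i)).
Proof.
  intros [H1 H2 H3 H4]. split.
  - intros i. rewrite Nat.add_assoc. apply H1.
  - intros i. rewrite Nat.add_succ_r. apply H2.
  - intros i j g E. destruct (H3 _ _ _ E) as [c Hc]. exists c. lia.
  - intros i g. rewrite !Nat.add_succ_r. apply H4.
Qed.

Lemma loop_tpath t m y : loop t m y -> tpath y m.
Proof.
  intros [H1 H2 H3 H4]. split; auto. intros i j g Hi Hj E.
  destruct (H3 _ _ _ E) as [[|c] Hc]; simpl in Hc; lia.
Qed.

Lemma loop_last t m y : loop t m y -> y (S m) = act t (y 0).
Proof. intros H. apply (loop_shift _ _ _ H 0). Qed.

(** If the closing edge were a tree pair, an element fixing [y m] would carry [y (m + 1)] to [y 0],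
    making [y 0] adjacent to [y m], which has depth [m]. The form [1 + m] avoids the bound name
    [S]. *)
Lemma loop_transversal t m y : loop t m y ->
  exists S, transversal act arc (rt (y 0)) S /\ (forall k, k <= m -> S (y k)) /\
   ~ tree_pair S (y m) (y (1 + m)).
Proof.
  intros Hy. assert (Hp := loop_tpath _ _ _ Hy).
  destruct (tpath_extend act arc HA (rt (y 0)) y m Hp eq_refl) as (T & HT & yT).
  exists T. split; [auto|split; [auto|]]. simpl. intros (g & Hm & Hm').
  apply (transversal_fix act arc (rt (y 0)) T HT) in Hm; [|now apply yT; lia].
  assert (H0 : act g (y (S m)) = y 0).
  { rewrite (loop_last _ _ _ Hy), <- (actM _ _ HA) in *.
    apply (transversal_fix act arc (rt (y 0)) T HT); auto. apply yT. lia. }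
  assert (Ha : adj (y m) (y 0)).
  { rewrite <- Hm, <- H0. apply (adj_act act arc HA), Hy. }
  destruct (adj_par _ _ (rt (y 0)) _ _ Ha) as [[]|[Hr Hpar]]; [congruence|].
  assert (D := dep_par _ _ (rt (y 0)) _ Hr).
  rewrite Hpar, (dep_root _ _ (rt (y 0))) in D.
  destruct (tpath_dep act arc HA (rt (y 0)) y m Hp eq_refl m (le_n m)) as [D' _].
  assert (m = 1) as -> by lia.
  (* For [m = 1] the adjacency is possible, but the two edges would be folded together. *)
  now apply (loop_fold _ _ _ Hy 0 g).
Qed.

(** After translation the edge leaves the transversal at [u'] and ends at [t s] with [s] in the
    transversal. The path from [s] to [u'] followed by this edge is one period, continued by the
    powers of [t]. *)
Lemma loop_exists r T u w : transversal act arc (rt r) T -> adj u w -> ~ tree_pair T u w ->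
  exists t m y, loop t m y.
Proof.
  intros HT Ha Nt.
  destruct (proj2 (proj2 HT) u) as [h Hu].
  apply (adj_act act arc HA h) in Ha. rewrite <- (tree_pair_act act arc HA T h) in Nt.
  set (u' := act h u) in *. set (w' := act h w) in *. clearbody u' w'. clear u w h.
  destruct (proj2 (proj2 HT) w') as [h Hw].
  pose (t := h^-1). set (s := act h w') in *.
  assert (Ew : w' = act t s) by (symmetry; apply (actK act arc HA)).
  assert (HT' := transversal_reroot act arc r s (rt r) (rt s) T HT Hw).
  pose (x := ancestor arc (rt s) u'). pose (m := dep (rt s) u').
  assert (Hx : tpath x m) by now apply (ancestor_tpath act arc (rt s) T).
  assert (x0 : x 0 = s) by apply ancestor_0.
  assert (xm : x m = u') by apply ancestor_self.
  assert (xT : forall k, T (x k)) by (intros k; apply ancestor_in; auto; apply HT').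
  pose (tp := fun q => gpow_nat G t q).
  pose (y := fun k => act (tp (k / S m)) (x (k mod S m))).
  (* The successor of [x i] within one period; the last one is [t s]. *)
  pose (z := fun i => if lt_dec i m then x (S i) else act t (x 0)).
  assert (tpS : forall q, tp (S q) = t ** tp q) by reflexivity.
  assert (tpS' : forall q, tp (S q) = tp q ** t).
  { induction q as [|q IH]; [now rewrite tpS; unfold tp; simpl; gsimp|].
    rewrite tpS, IH at 1. now rewrite gmulA, <- tpS. }
  assert (y_next : forall k, y (S k) = act (tp (k / S m)) (z (k mod S m))).
  { intros k. assert (Dk := Nat.div_mod_eq k (S m)).
    assert (Bk := Nat.mod_upper_bound k (S m) ltac:(lia)).
    unfold y, z. destruct (lt_dec (k mod S m) m) as [Hlt|Hge].
    - rewrite <- (Nat.div_unique (S k) (S m) (k / S m) (S (k mod S m))) by lia.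
      now rewrite <- (Nat.mod_unique (S k) (S m) (k / S m) (S (k mod S m))) by lia.
    - rewrite <- (Nat.div_unique (S k) (S m) (S (k / S m)) 0) by lia.
      rewrite <- (Nat.mod_unique (S k) (S m) (S (k / S m)) 0) by lia.
      now rewrite tpS', (actM _ _ HA). }
  assert (z_adj : forall i, i <= m -> adj (x i) (z i)).
  { intros i Hi. unfold z. destruct (lt_dec i m) as [Hlt|Hge]; [now apply Hx|].
    assert (i = m) as -> by lia. rewrite xm, x0, <- Ew. exact Ha. }
  assert (y_tree : forall k, tree_pair T (y k) (y (S k)) <-> k mod S m < m).
  { intros k. assert (Bk := Nat.mod_upper_bound k (S m) ltac:(lia)).
    rewrite y_next. unfold y. rewrite (tree_pair_act act arc HA). unfold z.
    destruct (lt_dec (k mod S m) m) as [Hlt|Hge].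
    - split; auto. intros _. exists gone. now rewrite !(act1 _ _ HA).
    - assert (k mod S m = m) as -> by lia. rewrite xm, x0, <- Ew. split; [tauto|lia]. }
  exists t, m, y. split.
  - intros k. unfold y. rewrite <- (actM _ _ HA), <- tpS.
    replace (k + S m) with (k + 1 * S m) by lia.
    rewrite Nat.div_add, Nat.Div0.mod_add by lia. now rewrite Nat.add_1_r.
  - intros k. rewrite y_next. apply (adj_act act arc HA), z_adj.
    assert (Bk := Nat.mod_upper_bound k (S m) ltac:(lia)). lia.
  - intros i j g E. unfold y in E.
    assert (Di := Nat.div_mod_eq i (S m)). assert (Bi := Nat.mod_upper_bound i (S m) ltac:(lia)).
    assert (Dj := Nat.div_mod_eq j (S m)). assert (Bj := Nat.mod_upper_bound j (S m) ltac:(lia)).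
    assert (M : i mod S m = j mod S m).
    { apply (proj2 Hx _ _ ((tp (j / S m))^-1 ** (g ** tp (i / S m)))); try lia.
      rewrite !(actM _ _ HA), <- E. symmetry. apply (actK act arc HA). }
    destruct (le_lt_dec (i / S m) (j / S m)).
    + exists (j / S m - i / S m). right. nia.
    + exists (i / S m - j / S m). left. nia.
  (* For [m = 1] tree edges and non-tree edges alternate along the line, so no element exchanges two
     consecutive ones. *)
  - intros k g Em H1 H2.
    assert (K : tree_pair T (y (S k)) (y (S (S k))) <-> tree_pair T (y k) (y (S k))).
    { rewrite <- (tree_pair_act act arc HA T g), H1, H2. split; apply tree_pair_sym. }
    rewrite !y_tree, Em in K.
    assert (Di := Nat.div_mod_eq k 2). assert (Bi := Nat.mod_upper_bound k 2 ltac:(lia)).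
    assert (Dj := Nat.div_mod_eq (S k) 2). assert (Bj := Nat.mod_upper_bound (S k) 2 ltac:(lia)).
    lia.
Qed.

Section Incident.
Context (uniq : forall r T u1 w1 u2 w2, transversal act arc (rt r) T ->
  arc u1 w1 -> ~ tree_pair T u1 w1 -> arc u2 w2 -> ~ tree_pair T u2 w2 ->
  exists g, u2 = act g u1 /\ w2 = act g w1).
Context (t : G) (m : nat) (y : nat -> V) (Hy : loop t m y).

Context (T : V -> Prop) (HT : transversal act arc (rt (y 0)) T) (yT : forall k, k <= m -> T (y k)).
Context (Hclose : ~ tree_pair T (y m) (y (S m))).

(** By [uniq] the edge is a translate of the closing edge or of its reverse. The translating element
    takes a vertex of [T] into [T], hence fixes it. *)
Lemma non_tree_incident u w : T u -> adj u w -> ~ tree_pair T u w ->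
  (u = y m /\ exists g, stab (y m) g /\ w = act g (y (S m))) \/
  (u = y 0 /\ exists g, stab (y 0) g /\ w = act g (act (t^-1) (y m))).
Proof.
  intros Tu Ha Nt.
  assert (K : exists g, (u = act g (y m) /\ w = act g (y (S m))) \/ (u = act g (y (S m)) /\ w = act g (y m))).
  { assert (Nt' : ~ tree_pair T w u) by (intros H; apply Nt; now apply tree_pair_sym).
    assert (Hclose' : ~ tree_pair T (y (S m)) (y m)) by (intros H; apply Hclose; now apply tree_pair_sym).
    destruct (loop_adj _ _ _ Hy m) as [A|A], Ha as [B|B].
    - destruct (uniq _ T _ _ _ _ HT A Hclose B Nt) as [g []]. eauto.
    - destruct (uniq _ T _ _ _ _ HT A Hclose B Nt') as [g []]. eauto.
    - destruct (uniq _ T _ _ _ _ HT A Hclose' B Nt) as [g []]. eauto.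
    - destruct (uniq _ T _ _ _ _ HT A Hclose' B Nt') as [g []]. eauto. }
  destruct K as [g [[-> ->]|[-> ->]]].
  - left. assert (E : act g (y m) = y m) by (apply (transversal_fix act arc _ T HT); auto).
    split; auto. exists g. auto.
  - right. rewrite (loop_last _ _ _ Hy), <- (actM _ _ HA) in *.
    assert (E : act (g ** t) (y 0) = y 0).
    { apply (transversal_fix act arc _ T HT); auto. apply yT. lia. }
    split; auto. exists (g ** t). split; auto. rewrite <- (actM _ _ HA). now gsimp.
Qed.
End Incident.
End QuotientLoops.

(** * Quotient graphs with one cycle *)

Section OneLoop.
Context {G : group} {V : Type} (act : G -> V -> V) (arc : V -> V -> Prop).
Notation adj := (adjacent arc).
Notation stab := (stab act).
Notation tree_pair := (tree_pair act).
Notation tpath := (tpath act arc).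
Context (HA : arc_action act arc).
Context (rt : forall r, rooted adj r).
Context (stab_fgtf : forall v, fgtf_abelian (stab v)).
Context (edge_factor : forall u w, adj u w -> direct_factor G (fun g => stab u g /\ stab w g) (stab w)).
Context (csa : forall x y z : G, x ** y = y ** x -> z ** x ** z^-1 = y -> x = y).
Context (uniq : forall r T u1 w1 u2 w2, transversal act arc (rt r) T ->
  arc u1 w1 -> ~ tree_pair T u1 w1 -> arc u2 w2 -> ~ tree_pair T u2 w2 ->
  exists g, u2 = act g u1 /\ w2 = act g w1).

Definition seg_stab (y : nat -> V) (i k : nat) (g : G) : Prop := forall l, i <= l <= k -> stab (y l) g.

Lemma seg_stab_subgroup y i k : is_subgroup G (seg_stab y i k).
Proof.
  repeat split.
  - intros l _. apply (stab_subgroup act arc HA).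
  - intros a b Ha Hb l Hl. apply (stab_subgroup act arc HA); auto.
  - intros a Ha l Hl. apply (stab_subgroup act arc HA); auto.
Qed.

(** [g] and its conjugate lie in one abelian stabilizer, so they commute, and [csa] makes them
    equal. *)
Lemma conj_stab_commute v g t : stab v g -> stab v (t^-1 ** g ** t) -> t ** g = g ** t.
Proof.
  intros Hg Hg'. assert (E : g = t^-1 ** g ** t).
  { apply (csa _ _ (t^-1)); [apply (stab_comm act stab_fgtf v); auto|]. now rewrite ginvK. }
  rewrite E at 1. now gsimp.
Qed.

Section LoopStab.
Context (t : G) (m : nat) (y : nat -> V) (Hy : loop act arc t m y).
(** The vertex of the line just before [y 0]. *)
Let z := act (t^-1) (y m).

Lemma loop_prev_adj : adj z (y 0).
Proof.
  assert (H := loop_adj _ _ _ _ _ Hy m). apply (adj_act act arc HA (t^-1)) in H.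
  now rewrite (loop_last _ _ _ _ _ Hy), (actK _ _ HA) in H.
Qed.

Lemma stab_prev g : t ** g = g ** t -> stab (y m) g -> stab z g.
Proof.
  intros C Hg. apply (stab_conj act arc HA). rewrite ginvK, C.
  now rewrite <- gmulA, gmulVr, gmul1r.
Qed.

(** Since [g] fixes [y 0] and its translate by [t], it commutes with [t]; as it fixes [y m], it
    fixes the translate [z]. *)
Lemma loop_seg_stab g : seg_stab y 0 (S m) g -> stab z g.
Proof.
  intros Hg. apply stab_prev; [|apply Hg; lia].
  apply (conj_stab_commute (y 0)); [apply Hg; lia|].
  apply (stab_conj act arc HA). rewrite <- (loop_last _ _ _ _ _ Hy). apply Hg. lia.
Qed.

(* [j] is the last index such that the pointwise stabilizer of [y 0 .. y j] does not fix [z]; the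
   functionals kill the stabilizers of the segments that go on to [y (j + 1)], so that they can be
   continued by zero, and they kill the edge from [z] to [y 0]. *)
Lemma loop_functionals x : stab (y 0) x -> ~ stab z x ->
  exists lam : nat -> G -> Z,
    (forall i, zhom_on (stab (y i)) (lam i)) /\
    (forall i g, stab (y i) g -> stab (y (S i)) g -> lam i g = lam (S i) g) /\
    (forall i, m < i -> forall g, lam i g = 0%Z) /\
    (forall g, stab z g -> stab (y 0) g -> lam 0 g = 0%Z) /\
    exists x', stab (y 0) x' /\ lam 0 x' <> 0%Z.
Proof.
  intros Hx Nx.
  destruct (dec_inh_nat_subset_has_unique_least_element
    (fun j => forall g, seg_stab y 0 (S j) g -> stab z g)) as (j & (Hj & Min) & _).
  { intros; apply classic. }
  { exists m. apply loop_seg_stab. }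
  assert (Hjm : j <= m) by (apply Min; apply loop_seg_stab).
  assert (exists x', seg_stab y 0 j x' /\ ~ stab z x') as (x' & Hx' & Nx').
  { destruct j as [|j].
    - exists x. split; auto. intros l Hl. now assert (l = 0) as -> by lia.
    - apply NNPP. intros No. assert (S j <= j); [|lia]. apply Min.
      intros g Hg. apply NNPP. intros Ng. apply No. eauto. }
  assert (Hx0 : stab (y 0) x') by (apply Hx'; lia).
  assert (Fam : forall k, k <= j -> exists lam : nat -> G -> Z,
    (forall i, i <= k -> zhom_on (stab (y i)) (lam i) /\ forall g, seg_stab y i (S j) g -> lam i g = 0%Z) /\
    (forall i g, i < k -> stab (y i) g -> stab (y (S i)) g -> lam i g = lam (S i) g) /\
    (forall g, stab z g -> stab (y 0) g -> lam 0 g = 0%Z) /\ lam 0 x' <> 0%Z).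
  { induction k as [|k IH]; intros Hk.
    (* By the choice of [j], killing the edge from [z] also kills the stabilizer of
       [y 0 .. y (j + 1)]. *)
    - destruct (zhom_separate (fun g => stab z g /\ stab (y 0) g) (stab (y 0)) x') as (f & Hf & Kf & Nf); auto.
      { apply edge_factor, loop_prev_adj. }
      { tauto. }
      exists (fun _ => f). split; [|split; [lia|auto]].
      intros i Hi. assert (i = 0) as -> by lia. split; [exact Hf|].
      intros g Hg. apply Kf. split; [now apply Hj|apply Hg; lia].
    - destruct IH as (lam & H1 & H2 & H3 & H4); [lia|].
      (* An edge element that also fixes [y (k + 1) .. y (j + 1)] fixes the segment from [y k],
         where [lam k] vanishes, so the two demands are compatible. *)
      destruct (zhom_extend_kill (stab (y (S k))) (fun g => stab (y k) g /\ stab (y (S k)) g)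
        (seg_stab y (S k) (S j)) (lam k)) as (N & f & HN & Hf & Ef & Kf); auto.
      + apply subgroup_cap; apply (stab_subgroup act arc HA).
      + apply seg_stab_subgroup.
      + tauto.
      + intros g h [Hg _] [Hh _]. destruct (H1 k (le_n k)) as [Hl _]. now apply Hl.
      + intros g [Hg _] Hg'. apply (proj2 (H1 k (le_n k))). intros l Hl.
        destruct (Nat.eq_dec l k) as [->|]; auto. apply Hg'. lia.
      (* Multiplying the earlier functionals by [N] restores agreement with the new one. *)
      + exists (fun i g => if le_dec i k then (N * lam i g)%Z else f g). split; [intros i Hik; split|split; [|split]].
        * intros g h Hg Hh. destruct (le_dec i k) as [Hi|Hi].
          -- destruct (H1 i Hi) as [Hl _]. rewrite Hl by auto. lia.
          -- assert (i = S k) as -> by lia. now apply Hf.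
        * intros g Hg. destruct (le_dec i k) as [Hi|Hi].
          -- destruct (H1 i Hi) as [_ Hl]. rewrite Hl by auto. lia.
          -- assert (i = S k) as -> by lia. now apply Kf.
        * intros i g Hi Hg Hg'. destruct (le_dec i k); [|lia]. destruct (le_dec (S i) k).
          -- rewrite (H2 i g); auto.
          -- assert (i = k) as -> by lia. symmetry. now apply Ef.
        * intros g Hg Hg'. simpl. rewrite H3 by auto. lia.
        * simpl. nia. }
  destruct (Fam j (le_n j)) as (lam & H1 & H2 & H3 & H4).
  (* Continuing by zero is consistent: [lam j] kills the stabilizer of the edge from [y j] to
     [y (j + 1)]. *)
  exists (fun i g => if le_dec i j then lam i g else 0%Z). split; [|split; [|split; [|split]]].
  - intros i g h Hg Hh. destruct (le_dec i j) as [Hi|Hi]; [|lia]. destruct (H1 i Hi) as [Hl _]. now apply Hl.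
  - intros i g Hg Hg'. destruct (le_dec i j) as [Hi|Hi], (le_dec (S i) j) as [Hi'|Hi']; auto; try lia.
    assert (i = j) as -> by lia. apply (proj2 (H1 j (le_n j))). intros l Hl.
    assert (l = j \/ l = S j) as [-> | ->] by lia; auto.
  - intros i Hi g. destruct (le_dec i j); [lia|auto].
  - intros g Hg Hg'. simpl. auto.
  - exists x'. simpl. auto.
Qed.

(** The functionals map to powers of the first generator and vanish at both sides of the cut, so the
    stable letter may go to the second. *)
Lemma maps_onto_F2_growing_loop x : stab (y 0) x -> ~ stab z x -> maps_onto_F2 G.
Proof.
  intros Hx Nx. destruct (loop_functionals x Hx Nx) as (lam0 & Hlam0 & A0 & O0 & K0 & x' & Hx' & Nx').
  destruct (zhom_primitive (fun i => stab (y i)) lam0 0 x') as (lam & N & HN & E & Hlam & Im); auto.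
  { intros i. apply (stab_subgroup act arc HA). }
  assert (A : forall i g, stab (y i) g -> stab (y (S i)) g -> lam i g = lam (S i) g).
  { intros i g H1 H2. specialize (A0 i g H1 H2). rewrite !E in A0 by auto. nia. }
  assert (O : forall i g, m < i -> stab (y i) g -> lam i g = 0%Z).
  { intros i g Hi Hg. specialize (O0 i Hi g). rewrite E in O0 by auto. nia. }
  assert (K : forall g, stab z g -> stab (y 0) g -> lam 0 g = 0%Z).
  { intros g H1 H2. specialize (K0 g H1 H2). rewrite E in K0 by auto. nia. }
  clear lam0 Hlam0 A0 O0 K0 E x' Hx' Nx'.
  destruct (loop_transversal act arc HA rt t m y Hy) as (T & HT & yT & Hc).
  assert (Hp := loop_tpath act arc t m y Hy).
  pose (idx := fun v => epsilon (inhabits 0) (fun i => i <= m /\ v = y i)).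
  assert (idx_y : forall i, i <= m -> idx (y i) = i).
  { intros i Hi. assert (Hs : idx (y i) <= m /\ y i = y (idx (y i))).
    { unfold idx. apply epsilon_spec. eauto. }
    destruct Hs as [H1 H2]. symmetry. now apply (tpath_inj act arc HA y m). }
  pose (phi := fun v g => gzpow F2 (F2letter true) (lam (idx v) g)).
  assert (phi_y : forall i g, i <= m -> phi (y i) g = gzpow F2 (F2letter true) (lam i g)).
  { intros i g Hi. unfold phi. now rewrite idx_y. }
  destruct (bass_serre_hom_propagated act arc HA (rt (y 0)) T HT (L := F2) (fun v => exists k, k <= m /\ v = y k))
    with (phi := phi) (gam := fun _ _ : V => F2letter false) as (f & Hf & Hphi & Hgam); auto.
  - now apply (tpath_pclosed act arc HA).
  - intros v (k & Hk & ->). auto.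
  - apply (stab_comm act stab_fgtf).
  - intros v (k & Hk & ->) g h Hg Hh. rewrite !phi_y by auto.
    now apply (gzpow_hom_on (stab (y k))).
  - intros w g (k & Hk & ->) Hr. destruct (tpath_dep act arc HA (rt (y 0)) y m Hp eq_refl k Hk) as [_ P].
    destruct k as [|k]; [now destruct Hr|]. destruct (P k eq_refl) as [_ ->]. intros Hg Hg'.
    rewrite !phi_y by lia. f_equal. now apply A.
  - intros u w g Tu Ha Ht.
    destruct (non_tree_incident act arc HA rt uniq t m y Hy T HT yT Hc u w Tu Ha Ht)
      as [(-> & h & Hh & ->)|(-> & h & Hh & ->)].
    + split; [eauto|]. intros Hg Hg'. apply (stab_conj act arc HA) in Hg'.
      (* [g] and [h] lie in the abelian stabilizer of [y m], so fixing the translate by [h] amounts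
         to fixing [y (m + 1)]. *)
      assert (C : h^-1 ** g ** h = g).
      { rewrite <- gmulA, (stab_comm act stab_fgtf (y m) g h) by auto. now gsimp. }
      rewrite C in Hg'. rewrite phi_y, A, O by (auto; lia). reflexivity.
    + split; [exists 0; split; [lia|auto]|]. intros Hg Hg'. apply (stab_conj act arc HA) in Hg'.
      assert (C : h^-1 ** g ** h = g).
      { rewrite <- gmulA, (stab_comm act stab_fgtf (y 0) g h) by auto. now gsimp. }
      rewrite C in Hg'. rewrite phi_y, K by (auto; lia). reflexivity.
  - apply (maps_onto_F2_of_hom G f Hf). intros [].
    + apply (Im F2 (F2letter true) f Hf). intros i g Hg. destruct (le_lt_dec i m) as [Hi|Hi].
      * exists g. rewrite <- phi_y by auto. apply Hphi; eauto.
      * exists gone. rewrite O by auto. now apply (hom_on_1 (stab (y i))); [apply stab_fgtf|intros ? ? _ _].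
    + destruct (loop_adj _ _ _ _ _ Hy m) as [B|B].
      * now apply (Hgam _ _ B).
      * apply (Hgam _ _ B). intros H. apply Hc. now apply tree_pair_sym.
Qed.

Section Constant.
Context (const : forall k, k <= m -> forall g, stab (y k) g <-> stab (y 0) g).
Context (central : forall g, stab (y 0) g -> t ** g = g ** t).

(** [G] is generated by the abelian stabilizer of [y 0] and by [t], which centralizes it. *)
Lemma abelian_of_constant_loop T : transversal act arc (rt (y 0)) T -> (forall k, k <= m -> T (y k)) ->
  ~ tree_pair T (y m) (y (S m)) -> (forall s g, T s -> stab s g -> stab (y 0) g) ->
  forall g h : G, g ** h = h ** g.
Proof.
  intros HT yT Hc Hs.
  assert (gen : forall U, is_subgroup G U -> (forall g, stab (y 0) g -> U g) -> U t -> forall g, U g).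
  { intros U HU HUs Ut. apply (generated_by_transversal act arc HA (rt (y 0)) T HT); auto.
    - intros s g Ts Hg. apply HUs. eauto.
    - intros u w Tu Ha Ht.
      destruct (non_tree_incident act arc HA rt uniq t m y Hy T HT yT Hc u w Tu Ha Ht)
        as [(-> & h & Hh & ->)|(-> & h & Hh & ->)].
      (* This element brings the far end of the edge back to [y 0]; in the other case it is brought
         to [y m]. *)
      + exists (t^-1 ** h^-1). split.
        * apply HU; apply HU; auto. apply HUs. now apply (const m).
        * rewrite (actM _ _ HA), (actK _ _ HA), (loop_last _ _ _ _ _ Hy), (actK _ _ HA). apply yT. lia.
      + exists (t ** h^-1). split.
        * apply HU; auto. apply HU. auto.
        * rewrite (actM _ _ HA), (actK _ _ HA), (actVK _ _ HA). apply yT. lia. }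
  assert (C : forall g h, stab (y 0) h \/ h = t -> g ** h = h ** g).
  { apply (gen (fun g => forall h, stab (y 0) h \/ h = t -> g ** h = h ** g)).
    - apply (centralizer_subgroup (fun h => stab (y 0) h \/ h = t)).
    - intros g Hg h [Hh| ->]; [now apply (stab_comm act stab_fgtf (y 0))|]. symmetry. auto.
    - intros h [Hh| ->]; auto. }
  apply (gen (fun g => forall h, g ** h = h ** g)).
  - repeat split.
    + intros h. now gsimp.
    + intros a b Ha Hb h. now rewrite <- gmulA, Hb, gmulA, Ha, <- gmulA.
    + intros a Ha h. now apply commute_inv.
  - intros g Hg h. symmetry. auto.
  - intros h. symmetry. auto.
Qed.

(** Take [p] in [T] of least depth with a stabilizer not inside that of [y 0]. By minimality [p]
    carries a nonzero functional killing the edge to its parent; the stable letter gives the second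
    generator. *)
Lemma maps_onto_F2_constant_loop : ~ (forall g h : G, g ** h = h ** g) -> maps_onto_F2 G.
Proof.
  intros Hab. destruct (loop_transversal act arc HA rt t m y Hy) as (T & HT & yT & Hc).
  assert (Hp := loop_tpath act arc t m y Hy).
  pose (R := rt (y 0)).
  destruct (dec_inh_nat_subset_has_unique_least_element
    (fun n => exists p x, T p /\ dep R p = n /\ stab p x /\ ~ stab (y 0) x)) as (n & ((p & x & Tp & Dp & Hx & Nx) & Min) & _).
  { intros; apply classic. }
  { apply NNPP. intros No. apply Hab. apply (abelian_of_constant_loop T); auto.
    intros s g Ts Hg. apply NNPP. intros Ng. apply No. exists (dep R s), s, g. auto. }
  assert (Hpr : p <> y 0) by congruence.
  assert (Dpar := dep_par _ _ R p Hpr).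
  assert (Tpar : T (par R p)) by now apply HT.
  assert (Npar : ~ stab (par R p) x).
  { intros H. assert (n <= dep R (par R p)); [|lia]. apply Min. eauto 6. }
  assert (Hne : forall k, k <= m -> y k <> p).
  { intros k Hk <-. apply Nx. now apply (const k). }
  destruct (zhom_kill_edge act arc stab_fgtf edge_factor (par R p) p x (par_adj _ _ R p Hpr) Hx Npar)
    as (lam & Hlam & Klam & Im).
  pose (phi := fun v g => if excluded_middle_informative (v = p) then gzpow F2 (F2letter true) (lam g) else gone).
  assert (phi_p : forall g, phi p g = gzpow F2 (F2letter true) (lam g)).
  { intros g. unfold phi. now destruct excluded_middle_informative. }
  assert (phi_o : forall v g, v <> p -> phi v g = gone).
  { intros v g Hv. unfold phi. now destruct excluded_middle_informative. }
  (* [D] must contain the cycle, because the non-tree edges start there. *)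
  pose (D := fun v => T v /\ (dep R v < dep R p \/ v = p \/ exists k, k <= m /\ v = y k)).
  destruct (bass_serre_hom_propagated act arc HA R T HT (L := F2) D)
    with (phi := phi) (gam := fun _ _ : V => F2letter false) as (f & Hf & Hphi & Hgam); auto.
  - split.
    + split; [apply yT; lia|]. right; right. exists 0. split; [lia|auto].
    + intros v [Tv Hv] Hr. split; [now apply HT|].
      assert (Dv := dep_par _ _ R v Hr).
      destruct Hv as [Hv|[->|(k & Hk & ->)]]; [left; lia|left; lia|].
      right; right. destruct (tpath_dep act arc HA R y m Hp eq_refl k Hk) as [_ P].
      destruct k as [|k]; [now destruct Hr|]. exists k. split; [lia|]. now apply P.
  - intros v [Tv _]. exact Tv.
  - apply (stab_comm act stab_fgtf).
  - intros s _ g h Hg Hh. destruct (classic (s = p)) as [->|Hs].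
    + rewrite !phi_p. now apply (gzpow_hom_on (stab p)).
    + rewrite !phi_o by auto. now rewrite gmul1.
  - intros w g [Tw Hw] Hr Hg Hg'. assert (Dw := dep_par _ _ R w Hr).
    destruct (classic (w = p)) as [->|Hwp].
    + rewrite (phi_o (par R p)), phi_p, Klam; auto. intros E. rewrite E in Dw. lia.
    (* A child of [p] is too deep for [D] unless it is some [y k], and the parent of such a vertex
       is on the cycle, unlike [p]. *)
    + rewrite (phi_o w) by auto. apply phi_o. intros E.
      destruct Hw as [Hw|[Hw|(k & Hk & ->)]]; [rewrite E in Dw; lia|auto|].
      destruct (tpath_dep act arc HA R y m Hp eq_refl k Hk) as [_ P].
      destruct k as [|k]; [now destruct Hr|]. destruct (P k eq_refl) as [_ E'].
      apply (Hne k); [lia|]. congruence.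
  - intros u w g Tu Ha Ht.
    assert (exists k, k <= m /\ u = y k) as (k & Hk & ->).
    { destruct (non_tree_incident act arc HA rt uniq t m y Hy T HT yT Hc u w Tu Ha Ht)
        as [(-> & _)|(-> & _)]; [exists m|exists 0]; split; auto; lia. }
    split; [split; eauto|]. intros _ _. apply phi_o. auto.
  - apply (maps_onto_F2_of_hom G f Hf). intros [].
    + apply Im; auto. intros g Hg. rewrite <- phi_p. apply Hphi; auto. split; auto.
    + destruct (loop_adj _ _ _ _ _ Hy m) as [B|B].
      * now apply (Hgam _ _ B).
      * apply (Hgam _ _ B). intros H. apply Hc. now apply tree_pair_sym.
Qed.
End Constant.
End LoopStab.

(** If the stabilizers grow at some step, the loop is restarted there. Otherwise they decrease along
    the line, and translation by [t] makes them constant. *)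
Lemma maps_onto_F2_of_loop t m y : loop act arc t m y ->
  ~ (forall g h : G, g ** h = h ** g) -> maps_onto_F2 G.
Proof.
  intros Hy Hab.
  destruct (classic (exists k x, stab (y (S k)) x /\ ~ stab (y k) x)) as [(k & x & Hx & Nx)|No].
  - assert (Hy' := loop_from act arc t m y (S k) Hy).
    apply (maps_onto_F2_growing_loop t m _ Hy' x).
    + now rewrite Nat.add_0_r.
    + replace (S k + m) with (k + S m) by lia.
      now rewrite (loop_shift _ _ _ _ _ Hy), (actK _ _ HA).
  - assert (Dec : forall i k g, stab (y (k + i)) g -> stab (y i) g).
    { induction k as [|k IH]; intros g Hg; auto. apply IH. apply NNPP. intros Ng. apply No. eauto. }
    assert (Cen : forall g, stab (y 0) g -> t ** g = g ** t).
    { intros g Hg.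
      assert (Hg' : stab (y (S m)) (t ** g ** t^-1)).
      { rewrite (loop_last _ _ _ _ _ Hy). apply (stab_conj act arc HA). now gsimp. }
      (* [t g t^-1] fixes [y (m + 1)], hence [y 0], as does its conjugate [g]; so [t] commutes with
         it and therefore with [g]. *)
      assert (C : t ** (t ** g ** t^-1) = (t ** g ** t^-1) ** t).
      { apply (conj_stab_commute (y 0)).
        - apply (Dec 0 (S m)). now rewrite Nat.add_0_r.
        - now gsimp. }
      gsimp_in C. apply gcancel in C. rewrite <- C at 2. now gsimp. }
    apply (maps_onto_F2_constant_loop t m y Hy); auto.
    intros k Hk g. split; [intros Hg; apply (Dec 0 k); now rewrite Nat.add_0_r|].
    intros Hg. apply (Dec k (S m - k)). replace (S m - k + k) with (S m) by lia.
    rewrite (loop_last _ _ _ _ _ Hy). apply (stab_conj act arc HA).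
    rewrite <- gmulA, <- (Cen g) by auto. now gsimp.
Qed.
End OneLoop.

(** * Assembling the three cases *)

Lemma abelian_solvable (G : group) : (forall x y : G, x ** y = y ** x) -> solvable G.
Proof.
  intros C. exists 1. intros g (l & _ & ->). induction l as [|[x y] l IH]; simpl; auto.
  rewrite IH. unfold commutator. rewrite (C x y). now gsimp.
Qed.

(** Arguing by contradiction gives [uniq]: two orbits of non-tree edges would already yield a map
    onto [F2]. *)
Lemma maps_onto_F2_of_action {G : group} {V : Type} (act : G -> V -> V) (arc : V -> V -> Prop) (r : V) :
  arc_action act arc ->
  (forall r, rooted (adjacent arc) r) ->
  (forall v, fgtf_abelian (stab act v)) ->
  (forall u w, adjacent arc u w ->
    direct_factor G (fun g => stab act u g /\ stab act w g) (stab act w)) ->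
  (forall x y z : G, x ** y = y ** x -> z ** x ** z^-1 = y -> x = y) ->
  ~ (forall x y : G, x ** y = y ** x) -> maps_onto_F2 G.
Proof.
  intros HA rt Hstab Hfac Hcsa Hab. apply NNPP. intros No.
  assert (uniq : forall r T u1 w1 u2 w2, transversal act arc (rt r) T ->
    arc u1 w1 -> ~ tree_pair act T u1 w1 -> arc u2 w2 -> ~ tree_pair act T u2 w2 ->
    exists g, u2 = act g u1 /\ w2 = act g w1).
  { intros p T u1 w1 u2 w2 HT A1 N1 A2 N2. apply NNPP. intros Ng. apply No.
    now apply (maps_onto_F2_of_two_loops act arc HA p (rt p) T u1 w1 u2 w2). }
  apply No.
  destruct (classic (exists p T u w, transversal act arc (rt p) T /\ adjacent arc u w /\ ~ tree_pair act T u w))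
    as [(p & T & u & w & HT & Ha & Nt)|Nl].
  - destruct (loop_exists act arc HA rt p T u w HT Ha Nt) as (t & m & y & Hy).
    now apply (maps_onto_F2_of_loop act arc HA rt Hstab Hfac Hcsa uniq t m y).
  - apply (maps_onto_F2_quotient_tree act arc HA rt Hstab Hfac r); auto.
    intros p T u w HT Ha. apply NNPP. intros Nt. apply Nl. now exists p, T, u, w.
Qed.

Theorem theorem5p1 (G : group) (V E : Type) (src tgt : E -> V)
    (av : G -> V -> V) (ae : G -> E -> E) (M : nat) :
  is_tree V E src tgt ->
  graph_action G V E src tgt av ae ->
  (forall v : V, free_abelian_rank_le G M (vstab G V av v)) ->
  (forall e : E, direct_factor G (estab G E ae e) (vstab G V av (src e)) /\
                 direct_factor G (estab G E ae e) (vstab G V av (tgt e))) ->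
  (forall x y z : G, gmul x y = gmul y x -> gmul (gmul z x) (ginv z) = y -> x = y) ->
  ~ solvable G ->
  maps_onto_F2 G.
Proof.
  intros tree (V1 & VM & E1 & EM & Hsrc & Htgt) Hfree Hfac Hcsa Hsol.
  destruct (proj1 tree) as [r].
  assert (HA : arc_action av (fun u w => exists e, src e = u /\ tgt e = w)).
  { split; auto.
    - intros g u w (e & <- & <-). exists (ae g e). auto.
    (* Edges with the same ends coincide, so opposite arcs force [u = w], while adjacent vertices
       have different depths. *)
    - intros u w (e & Hu & Hw) (e' & Hw' & Hu').
      assert (J : joins src tgt e u w) by (left; auto).
      assert (J' : joins src tgt e' u w) by (right; auto).
      rewrite <- (edge_unique src tgt tree r e e' u w J J') in *.
      destruct (joins_lower src tgt tree r e u w J); subst; rewrite Hw' in *; lia. }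
  apply (maps_onto_F2_of_action av (fun u w => exists e, src e = u /\ tgt e = w) r HA); auto.
  (* [tree_rooted] only asserts inhabitation; choice turns it into a function of the root. *)
  - intros p. destruct (constructive_indefinite_description
      (fun _ : rooted (adjacent (fun u w => exists e, src e = u /\ tgt e = w)) p => True)) as [T _]; auto.
    destruct (tree_rooted src tgt p tree) as [T]. now exists T.
  - intros v. apply (free_abelian_fgtf M); [apply (stab_subgroup _ _ HA)|apply Hfree].
  (* An element fixing both ends of [e] maps it to an edge with the same ends, that is, to [e]. *)
  - assert (K : forall e u w, joins src tgt e u w -> (fun g => stab av u g /\ stab av w g) = estab G E ae e).
    { intros e u w He. apply functional_extensionality. intros g. apply propositional_extensionality.
      unfold stab, estab. split.
      - intros [Hu Hw]. apply (edge_unique src tgt tree r _ _ u w); auto.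
        destruct He as [[<- <-]|[<- <-]]; [left|right]; rewrite Hsrc, Htgt; auto.
      - intros Hg. assert (Hs := Hsrc g e). assert (Ht := Htgt g e). rewrite Hg in Hs, Ht.
        destruct He as [[<- <-]|[<- <-]]; auto. }
    intros u w [[e [Hu Hw]]|[e [Hw Hu]]]; rewrite (K e) by (red; auto); destruct (Hfac e); subst; auto.
  - intros Hab. apply Hsol. now apply abelian_solvable.
Qed.
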